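(* Let $K\in L^2(0,2\pi)$ be fixed. Then there exist $N\in\mathbb{N}$ and $b_0>0$ such that for all $n\in\mathbb{N}$ with $n\geq N$ and all $b\geq b_0$, the function $$\Phi(\lambda)=1-e^{2\pi i\lambda}-\int_0^{2\pi}e^{i\lambda t}(-iK(t))\,dt$$ has precisely $2n+1$ zeros (counting multiplicity) inside the rectangle $$\mathcal{R}_{n,b}:=\{z\in\mathbb{C}\mid-(n+1/2)\leq\mathrm{Re}(z)\leq n+1/2,\ -b\leq\mathrm{Im}(z)\leq b\}.$$
   Context: $L^2(0,2\pi)$ consists of complex-valued functions; $\Phi$ is an entire function of $\lambda\in\mathbb{C}$. *)

(* Defs.v *)
From HB Require Import structures.
From mathcomp Require Import all_boot all_order all_algebra.
From mathcomp Require Import all_classical all_reals all_analysis.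
From mathcomp Require Import complex.

Set Implicit Arguments.
Unset Strict Implicit.
Unset Printing Implicit Defensive.

Import Order.TTheory GRing.Theory Num.Theory.
Import numFieldNormedType.Exports.

Local Open Scope classical_set_scope.
Local Open Scope ring_scope.
Local Open Scope complex_scope.

(* The exponential e^(x + iy) = e^x (cos y + i sin y). *)
Definition cexp (R : realType) (z : R[i]) : R[i] :=
  (expR (complex.Re z))%:C * (cos (complex.Im z) +i* sin (complex.Im z)).

Definition cintegral (R : realType) (D : set R) (f : R -> R[i]) : R[i] :=
  (\int[lebesgue_measure]_(t in D) complex.Re (f t))
    +i* (\int[lebesgue_measure]_(t in D) complex.Im (f t)).

(* Elements of the complex L^2 are represented by Borel functions, which are
   the measurable functions of the library; every class has such a
   representative. *)
Definition is_L2 (R : realType) (D : set R) (f : R -> R[i]) : Prop :=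
  [/\ measurable_fun D (fun t => complex.Re (f t)),
      measurable_fun D (fun t => complex.Im (f t)) &
      (\int[lebesgue_measure]_(t in D) ((Normc.normc (f t)) ^+ 2)%:E < +oo)%E].

(* The topology and the derivative are the complex ones: R[i]^o is the field
   R[i] seen as a normed space over itself. *)
Definition vanishing_order (R : realType) (f : R[i] -> R[i]) (z : R[i])
    (m : nat) : Prop :=
  exists g : R[i]^o -> R[i]^o,
    [/\ \forall w \near (z : R[i]^o), derivable g w 1,
        \forall w \near (z : R[i]^o), f w = (w - z) ^+ m * g w &
        g z != 0].

(* The list s contains each zero of f in A as many times as its multiplicity,
   and nothing else. *)
Definition has_zeros (R : realType) (f : R[i] -> R[i]) (A : set R[i])
    (N : nat) : Prop :=
  exists s : seq R[i],
    [/\ forall z, z \in s -> A z,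
        forall z, A z -> vanishing_order f z (count_mem z s) &
        size s = N].

Definition Phi (R : realType) (K : R -> R[i]) (z : R[i]) : R[i] :=
  1 - cexp ((2 * pi)%:C * 'i%C * z)
    - cintegral `]0, 2 * pi[ (fun t => cexp ('i%C * z * t%:C) * (- 'i%C * K t)).

Definition rectangle (R : realType) (n : nat) (b : R) : set R[i] :=
  [set z | - (n%:R + 2^-1) <= complex.Re z <= n%:R + 2^-1
            /\ - b <= complex.Im z <= b].

(* Main.v *)
(* Put f0(z) = 1 - e^(2 pi i z) and w(z) = max(1, e^(-2 pi Im z)).  The
   Riemann-Lebesgue lemma, uniformly in the complex frequency, gives
   |Phi - f0| <= eps w for |z| large, while |f0| >= c w as soon as z is at
   distance at least 1/2 from every integer.  Hence Rouche's theorem on the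
   circle |z| = n + 1/2 gives 2n + 1 zeros in the disc, and no zero lies in the
   symmetric difference of the disc and the rectangle, all of whose points are
   far from 0 and from the integers.

   No contour integral is needed for Rouche's theorem.  For polynomials, the
   mean of z p'(z) / p(z) over the M-th roots of unity (scaled by r) equals the
   sum of the 1 / (1 - (a / r)^M) over the roots a of p, and so tends to the
   number of roots in the disc of radius r; along the segment from q to p this
   number is an integer and a Lipschitz function of the parameter, hence
   constant.  An entire function is treated as a locally uniform limit of
   polynomials: after its zeros in the disc have been divided out, the
   quotient is bounded below there, so its polynomial approximations have no
   root in the disc. *)

Require Import Defs.
From mathcomp Require Import all_boot all_order all_algebra.
From mathcomp Require Import cyclic separable cyclotomic.
From mathcomp Require Import all_classical all_reals all_analysis.
From mathcomp Require Import complex measurable_realfun ring lra zify.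

Import Order.TTheory GRing.Theory Num.Theory.
Import numFieldNormedType.Exports.
Import Normc HBSimple.

Local Open Scope classical_set_scope.
Local Open Scope ring_scope.
Local Open Scope complex_scope.

(** * Complex norm and roots of unity *)

Section ComplexNorm.
Context {R : realType}.
Implicit Types (x y z : R[i]).

Lemma normCE z : `|z| = (normc z)%:C.
Proof. by []. Qed.

Lemma ReM (u v : R[i]) :
  complex.Re (u * v) = complex.Re u * complex.Re v - complex.Im u * complex.Im v.
Proof. by case: u => a b; case: v. Qed.

Lemma ImM (u v : R[i]) :
  complex.Im (u * v) = complex.Re u * complex.Im v + complex.Im u * complex.Re v.
Proof. by case: u => a b; case: v. Qed.

Lemma normc_ge0 z : 0 <= normc z.
Proof. by case: z => a b; apply: sqrtr_ge0. Qed.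

Lemma normc_eq0 z : (normc z == 0) = (z == 0).
Proof. by apply/eqP/eqP => [/eq0_normc|->//]; rewrite ?normc0. Qed.

Lemma normc_gt0 z : (0 < normc z) = (z != 0).
Proof. by rewrite lt_def normc_ge0 normc_eq0 andbT. Qed.

Lemma normcX z n : normc (z ^+ n) = normc z ^+ n.
Proof. by elim: n => [|n IH]; rewrite ?normc1// !exprS normcM IH. Qed.

Lemma normcB x y : normc (x - y) = normc (y - x).
Proof. by rewrite -normcN opprB. Qed.

Lemma normc_real (a : R) : normc a%:C = `|a|.
Proof. by rewrite /= expr0n addr0 sqrtr_sqr. Qed.

Lemma normc_i : normc 'i%C = 1 :> R.
Proof. by rewrite /= expr0n expr1n add0r sqrtr1. Qed.

Lemma normc_nat n : normc n%:R = n%:R :> R.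
Proof. by rewrite -(rmorph_nat (real_complex R)) normc_real ger0_norm. Qed.

Lemma normc_Re z : `|complex.Re z| <= normc z.
Proof. by case: z => a b /=; rewrite -sqrtr_sqr ler_wsqrtr// lerDl sqr_ge0. Qed.

Lemma normc_Im z : `|complex.Im z| <= normc z.
Proof. by case: z => a b /=; rewrite -sqrtr_sqr ler_wsqrtr// lerDr sqr_ge0. Qed.

Lemma normc_leReIm z : normc z <= `|complex.Re z| + `|complex.Im z|.
Proof.
rewrite [X in normc X]complexE; apply: (le_trans (le_normcD _ _)).
by rewrite normcM normc_i mul1r !normc_real.
Qed.

Lemma sqr_normcE z : normc z ^+ 2 = complex.Re z ^+ 2 + complex.Im z ^+ 2.
Proof. by case: z => a b /=; rewrite sqr_sqrtr// addr_ge0 ?sqr_ge0. Qed.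

Lemma ler_normc_sub x y : normc x - normc y <= normc (x - y).
Proof. by rewrite lerBlDr -{1}(subrK y x) le_normcD. Qed.

Lemma ler_normc_dist x y : normc x - normc (x - y) <= normc y.
Proof. by rewrite lerBlDl -{1}(subrK y x) le_normcD. Qed.

Lemma normc_sum (I : Type) (r : seq I) (P : pred I) (F : I -> R[i]) :
  normc (\sum_(i <- r | P i) F i) <= \sum_(i <- r | P i) normc (F i).
Proof.
elim/big_ind2 : _ => [|a u b v ha hb|//]; first by rewrite normc0.
by apply: (le_trans (le_normcD _ _)); apply: lerD.
Qed.

Lemma normc_div x y : normc (x / y) = normc x / normc y.
Proof. by rewrite normcM normcV. Qed.

End ComplexNorm.

(** * Primitive roots of unity and means over them *)

Section RootsOfUnity.
Context {R : realType}.
Implicit Types (x y z b : R[i]).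

(** In characteristic 0, ['X^n - 1] is separable, so it has [n] distinct roots in the algebraically
    closed field [R[i]]; that many unity roots must include a primitive one. *)
Lemma exists_prim_root n : (0 < n)%N -> exists z : R[i], n.-primitive_root z.
Proof.
pose p : {poly R[i]} := 'X^n - 1; have [r Dp] := closed_field_poly_normal p.
move=> n_gt0; rewrite (monicP _) ?monicXnsubC // scale1r in Dp.
have rn1: all n.-unity_root r by apply/allP=> z; rewrite -root_prod_XsubC -Dp.
have sz_r: (n < (size r).+1)%N.
  by rewrite -(size_prod_XsubC r id) -Dp size_XnsubC.
have [|z] := hasP (has_prim_root n_gt0 rn1 _ sz_r); last by exists z.
by rewrite -separable_prod_XsubC -Dp separable_Xn_sub_1 // pnatr_eq0 -lt0n.
Qed.

Lemma normc_unity_root n z : (0 < n)%N -> z ^+ n = 1 -> normc z = 1.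
Proof.
move=> n0 zn; apply/eqP; rewrite -(@pexpr_eq1 _ _ n) ?normc_ge0//.
by rewrite -normcX zn normc1.
Qed.

Lemma sum_prim_rootX n z j : n.-primitive_root z ->
  \sum_(k < n) (z ^+ k) ^+ j = if (n %| j)%N then n%:R else 0.
Proof.
move=> pz; under eq_bigr do rewrite -exprM mulnC exprM.
rewrite (prim_order_dvd pz); case: eqVneq => [zj|zj].
  by under eq_bigr do rewrite zj expr1n; rewrite sumr_const card_ord.
have /eqP := subrX1 (z ^+ j) n.
rewrite -exprM mulnC exprM (prim_expr_order pz) expr1n subrr eq_sym mulf_eq0.
by rewrite subr_eq0 (negbTE zj) => /eqP.
Qed.

(* The discrete form of the residue computation. *)
Lemma mean_prim_root_geom n z b : n.-primitive_root z -> b ^+ n != 1 ->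
  n%:R^-1 * \sum_(k < n) (z ^+ k / (z ^+ k - b)) = (1 - b ^+ n)^-1.
Proof.
move=> pz bn; have n0 := prim_order_gt0 pz.
have nn : n%:R != 0 :> R[i] by rewrite pnatr_eq0 -lt0n.
have dn : 1 - b ^+ n != 0 by rewrite subr_eq0 eq_sym.
apply: (mulfI nn); rewrite mulVKf//.
have zn k : (z ^+ k) ^+ n = 1 by rewrite -exprM mulnC exprM (prim_expr_order pz) expr1n.
have zb k : z ^+ k - b != 0.
  by apply: contraNneq bn => /subr0_eq <-; rewrite zn.
apply: (mulIf dn); rewrite mulfVK// mulr_suml.
have z0 k : z ^+ k != 0.
  apply/eqP => zk; have /eqP := zn k.
  by rewrite zk expr0n eqn0Ngt n0 eq_sym oner_eq0.
(* Reading [1 - b ^+ n] as [(z ^+ k) ^+ n - b ^+ n] cancels the denominator. After summation over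
   [k] only [j = 0] survives, the one index with [n] dividing [n - j]. *)
transitivity (\sum_(k < n) \sum_(j < n) (z ^+ k) ^+ (n - j) * b ^+ j).
  apply: eq_bigr => k _; rewrite -(zn k) subrXX mulrA mulfVK// mulr_sumr.
  apply: eq_bigr => j _; rewrite mulrA -exprS.
  have jn : (j <= n.-1)%N by rewrite -ltnS prednK.
  by rewrite -subSn// prednK.
rewrite exchange_big /=; under eq_bigr do rewrite -mulr_suml sum_prim_rootX//.
rewrite (bigD1 (Ordinal n0)) //= subn0 dvdnn expr0 mulr1 big1 ?addr0// => j.
rewrite -val_eqE /= -lt0n => j0; rewrite gtnNdvd ?mul0r ?subn_gt0//.
by rewrite ltn_subrL j0 n0.
Qed.

End RootsOfUnity.

(** * Counting the roots of a polynomial *)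

Section PolynomialBounds.
Context {R : realType}.
Implicit Types (p q : {poly R[i]}) (r B : R).

(** Cauchy's estimate, with the contour integral replaced by a mean over [M]-th roots of unity.
    Taking [M = size p] gives enough points for orthogonality to isolate a single coefficient. *)
Lemma coef_le_circle p r B j : 0 < r ->
  (forall z, normc z = r -> normc p.[z] <= B) -> normc p`_j * r ^+ j <= B.
Proof.
move=> r0 pB; have B0 : 0 <= B.
  apply: le_trans (pB r%:C _); first exact: normc_ge0.
  by rewrite normc_real gtr0_norm.
have [ps|jp] := leqP (size p) j; first by rewrite nth_default// normc0 mul0r.
set M := size p in jp *; have M0 : (0 < M)%N by apply: leq_ltn_trans jp.
have [z pz] := @exists_prim_root R M M0.
have nz k : normc (z ^+ k) = 1.
  apply: (@normc_unity_root _ M) => //.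
  by rewrite -exprM mulnC exprM (prim_expr_order pz) expr1n.
have E : \sum_(k < M) p.[r%:C * z ^+ k] * (z ^+ k) ^+ (M - j)
         = M%:R * (p`_j * r%:C ^+ j).
  transitivity (\sum_(i < M) \sum_(k < M)
      (p`_i * r%:C ^+ i) * (z ^+ k) ^+ (i + (M - j))).
    rewrite exchange_big; apply: eq_bigr => k _.
    rewrite horner_coef mulr_suml; apply: eq_bigr => i _.
    by rewrite exprMn exprD !mulrA.
  under eq_bigr do rewrite -mulr_sumr sum_prim_rootX//.
  rewrite (bigD1 (Ordinal jp))//= subnKC ?(ltnW jp)// dvdnn mulrC.
  rewrite big1 ?addr0// => i; rewrite -val_eqE /= => ij.
  rewrite ifN ?mulr0//; apply: contra ij => Mi.
  have : (j + (i + (M - j)) == j + 0 %[mod M])%N by rewrite eqn_modDl mod0n.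
  by rewrite addnCA subnKC ?(ltnW jp)// addn0 modnDr !modn_small.
have : normc (M%:R * (p`_j * r%:C ^+ j)) <= M%:R * B.
  rewrite -E (le_trans (normc_sum _ _ _ _))//.
  rewrite mulr_natl -[X in _ <= _ *+ X](card_ord M) -sumr_const.
  apply: ler_sum => k _; rewrite normcM normcX nz expr1n mulr1.
  by apply: pB; rewrite normcM nz mulr1 normc_real gtr0_norm.
rewrite normcM normc_nat ler_pM2l ?ltr0n// normcM normcX normc_real.
by rewrite gtr0_norm.
Qed.

Lemma horner_normc_le p z :
  normc p.[z] <= \sum_(i < size p) normc p`_i * normc z ^+ i.
Proof.
rewrite horner_coef (le_trans (normc_sum _ _ _ _))//.
by apply: ler_sum => i _; rewrite normcM normcX.
Qed.

Lemma poly_bounded_disk p r :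
  exists2 C, 0 < C & forall z, normc z <= r -> normc p.[z] <= C.
Proof.
exists (1 + \sum_(i < size p) normc p`_i * `|r| ^+ i).
  by rewrite ltr_wpDr// sumr_ge0// => i _; rewrite mulr_ge0 ?normc_ge0 ?exprn_ge0.
move=> z zr; rewrite (le_trans (horner_normc_le _ _))// ler_wpDl//.
apply: ler_sum => i _; rewrite ler_wpM2l ?normc_ge0//.
by rewrite lerXn2r ?nnegrE ?normc_ge0// (le_trans zr)// ler_norm.
Qed.

(** A substitute for the maximum principle. Cauchy's estimate on the larger circle bounds the [i]-th
    term by [B * 2^-1 ^+ i] on the smaller disc, and the geometric series costs the factor 2. *)
Lemma poly_le_half_disk p r B : 0 < r ->
  (forall z, normc z = 2 * r -> normc p.[z] <= B) ->
  forall z, normc z <= r -> normc p.[z] <= 2 * B.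
Proof.
move=> r0 pB z zr; rewrite (le_trans (horner_normc_le _ _))//.
have B0 : 0 <= B.
  apply: le_trans (pB (2 * r)%:C _); first exact: normc_ge0.
  by rewrite normc_real gtr0_norm// mulr_gt0.
have geo n : \sum_(i < n) (2^-1 : R) ^+ i <= 2.
  suff -> : \sum_(i < n) (2^-1 : R) ^+ i = 2 - 2 * 2^-1 ^+ n.
    by rewrite gerBl mulr_ge0 ?exprn_ge0.
  elim: n => [|n IH]; first by rewrite big_ord0 expr0 mulr1 subrr.
  by rewrite big_ord_recr IH exprS/=; field.
rewrite mulrC; apply: le_trans (ler_wpM2l B0 (geo (size p))).
rewrite mulr_sumr; apply: ler_sum => i _.
have r2 : 0 < 2 * r by rewrite mulr_gt0.
have h := @coef_le_circle p (2 * r) B i r2 pB.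
rewrite exprVn ler_pdivlMr ?exprn_gt0//; apply: le_trans h.
rewrite -mulrA ler_wpM2l ?normc_ge0// mulrC exprMn.
rewrite ler_wpM2l ?exprn_ge0//.
by rewrite lerXn2r ?nnegrE ?normc_ge0// ltW.
Qed.

End PolynomialBounds.

(** * From logarithmic derivatives to root counts *)

Section CountingRoots.
Context {R : realType}.
Implicit Types (p q : {poly R[i]}) (s t : seq R[i]) (r : R).

Lemma expr_small (t e : R) : 0 <= t < 1 -> 0 < e ->
  exists M0, forall M, (M0 <= M)%N -> t ^+ M <= e.
Proof.
move=> /andP[t0 t1] e0.
have /cvgrPdist_le/(_ _ e0)[M0 _ H] := @cvg_expr R t (eq_ind_r (fun x => x < 1) t1 (ger0_norm t0)).
exists M0 => M /H; rewrite /= sub0r normrN normrX (ger0_norm t0); exact.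
Qed.

(** Up to sign the difference is [c ^+ M / (1 - c ^+ M)], with [c = b] inside the unit circle and
    [c = b^-1] outside, so one estimate serves both cases. *)
Lemma inv_one_sub_expr_cvg (b : R[i]) (e : R) : normc b != 1 -> 0 < e ->
  exists M0, forall M, (M0 <= M)%N ->
    b ^+ M != 1 /\
    normc ((1 - b ^+ M)^-1 - (normc b < 1)%R%:R) <= e.
Proof.
wlog e1 : e / e <= 1 => [H b1 e0|].
  have [||M0 HM] := H (Num.min e 1) _ b1; first by rewrite ge_min lexx orbT.
    by rewrite lt_min e0 ltr01.
  exists M0 => M /HM[h1 h2]; split => //; apply: (le_trans h2).
  by rewrite ge_min lexx.
move=> b1 e0; have e2 : 0 < e / 2 by lra.
have key c n : normc c ^+ n <= e / 2 ->
    c ^+ n != 1 /\ normc (c ^+ n / (1 - c ^+ n)) <= e.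
  move=> h; have {}h : normc (c ^+ n) <= e / 2 by rewrite normcX.
  have h1 : 1 - normc (c ^+ n) <= normc (1 - c ^+ n).
    by rewrite -{1}(@normc1 R) ler_normc_sub.
  have h2 : 2^-1 <= normc (1 - c ^+ n) by lra.
  split.
    apply/eqP => c1; move: h2; rewrite c1 subrr normc0 => ?; lra.
  rewrite normc_div ler_pdivrMr; last by lra.
  by apply: (le_trans h); apply: ler_wpM2l => //; lra.
have [bl|bg] := ltP (normc b) 1.
  have [|M0 HM] := @expr_small (normc b) (e / 2) _ e2; first by rewrite normc_ge0.
  exists M0 => M /HM /key[h1 h2]; split => //.
  rewrite (_ : _ - _ = b ^+ M / (1 - b ^+ M))//= mulr1n.
  have d0 : 1 - b ^+ M != 0 by rewrite subr_eq0 eq_sym.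
  by field.
have {b1}bg : 1 < normc b by rewrite lt_def b1.
have b0 : b != 0 by rewrite -normc_gt0; lra.
have [|M0 HM] := @expr_small (normc b^-1) (e / 2) _ e2.
  by rewrite normc_ge0 normcV/= invf_lt1//; lra.
exists M0 => M /HM /key[]; rewrite exprVn => h1 h2.
have bM : b ^+ M != 1 by apply: contraNneq h1 => ->; rewrite invr1.
split => //; rewrite subr0 -normcN (_ : - _ = (b ^+ M)^-1 / (1 - (b ^+ M)^-1))//.
have bM0 : b ^+ M != 0 by rewrite expf_neq0.
have d0 : 1 - b ^+ M != 0 by rewrite subr_eq0 eq_sym.
have d1 : b ^+ M - 1 != 0 by rewrite subr_eq0.
by field; rewrite bM0 d0 d1.
Qed.

(** A discrete argument principle. Each root [a] enters the geometric mean formula through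
    [b = a / r%:C], and its contribution tends to 1 or 0 according to the side of the circle. *)
Lemma mean_log_derivative_cvg s r (e : R) : 0 < r -> 0 < e ->
  {in s, forall a, normc a != r} ->
  exists M0, forall M (z : R[i]), (M0 <= M)%N -> M.-primitive_root z ->
    normc (M%:R^-1 * \sum_(k < M) \sum_(a <- s)
             (r%:C * z ^+ k / (r%:C * z ^+ k - a))
           - (count (fun a => (normc a < r)%R) s)%:R) <= e.
Proof.
move=> r0; have rC : r%:C != 0 :> R[i] by rewrite -normc_gt0 normc_real gtr0_norm.
elim: s e => [|a s IH] e e0 sr.
  exists 0 => M z _ _; under eq_bigr do rewrite big_nil.
  by rewrite sumr_const mul0rn mulr0 subr0 normc0 ltW.
have e2 : 0 < e / 2 by lra.
have [|M1 HM1] := IH _ e2; first by move=> x xs; apply: sr; rewrite inE xs orbT.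
have ar : normc (a / r%:C) != 1.
  rewrite normc_div normc_real gtr0_norm// -subr_eq0.
  rewrite -(divff (lt0r_neq0 r0)) -mulrBl mulf_eq0 invr_eq0 (gt_eqF r0) orbF.
  by rewrite subr_eq0 sr// mem_head.
have [M2 HM2] := inv_one_sub_expr_cvg _ _ ar e2.
exists (maxn M1 M2) => M z; rewrite geq_max => /andP[/HM1 h1 /HM2[aM h2]] pz.
under eq_bigr do rewrite big_cons.
rewrite big_split mulrDr /= natrD opprD addrACA.
rewrite [X in _ <= X]splitr (le_trans (le_normcD _ _))// lerD//; last exact: h1.
have -> : (normc a < r) = (normc (a / r%:C) < 1).
  by rewrite normc_div normc_real gtr0_norm// ltr_pdivrMr// mul1r.
rewrite -(@mean_prim_root_geom _ _ z) in h2 => //.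
move: h2; congr (normc (_ * _ - _) <= _); apply: eq_bigr => k _.
have zk : z ^+ k != a / r%:C.
  apply: contraNneq aM => <-.
  by rewrite -exprM mulnC exprM (prim_expr_order pz) expr1n.
have d : z ^+ k - a / r%:C != 0 by rewrite subr_eq0.
have d' : r%:C * z ^+ k - a != 0.
  by rewrite (_ : _ - _ = r%:C * (z ^+ k - a / r%:C)) ?mulf_neq0//; field.
by field; rewrite ?rC ?d'.
Qed.

Lemma log_derivative_prod_XsubC (c : R[i]) s (z : R[i]) :
  let p := c *: \prod_(a <- s) ('X - a%:P) in
  p.[z] != 0 -> p^`().[z] / p.[z] = \sum_(a <- s) (z - a)^-1.
Proof.
move=> /=; rewrite derivZ !hornerZ mulf_eq0 negb_or => /andP[c0 sz].
rewrite -mulf_div divff// mul1r; elim: s sz => [|a s IH].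
  by rewrite !big_nil derivC horner0 mul0r.
rewrite !big_cons hornerM mulf_eq0 negb_or hornerXsubC => /andP[az sz].
rewrite derivM derivXsubC mul1r hornerD hornerM hornerXsubC -IH//.
by field; rewrite sz az.
Qed.

(** The difference of the logarithmic derivatives is the Wronskian divided by [p * q], at most
    [L / delta ^+ 2] on the circle; the factor [r] is the modulus of [z] in [z p'(z) / p(z)]. The
    means are within any [e] of the counts for [M] large. *)
Lemma count_roots_dist (c d : R[i]) s t (r delta L : R) :
  let p := c *: \prod_(a <- s) ('X - a%:P) in
  let q := d *: \prod_(a <- t) ('X - a%:P) in
  0 < r -> 0 < delta ->
  (forall z, normc z = r -> [/\ delta <= normc p.[z], delta <= normc q.[z] &
     normc (p^`() * q - p * q^`()).[z] <= L]) ->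
  `|(count (fun a => (normc a < r)%R) s)%:R - (count (fun a => (normc a < r)%R) t)%:R|
    <= r * L / delta ^+ 2 :> R.
Proof.
move=> p q r0 d0 H; apply/ler_addgt0Pr => e e0; have e2 : 0 < e / 2 by lra.
have root_off (c' : R[i]) s' :
    (forall z, normc z = r -> (c' *: \prod_(a <- s') ('X - a%:P)).[z] != 0) ->
    {in s', forall a, normc a != r}.
  move=> h a as'; apply/eqP => /h; rewrite hornerZ mulf_eq0 negb_or => /andP[_].
  by rewrite -/(root _ a) root_prod_XsubC as'.
have p0 z : normc z = r -> p.[z] != 0.
  by move=> /H[h _ _]; rewrite -normc_gt0; lra.
have q0 z : normc z = r -> q.[z] != 0.
  by move=> /H[_ h _]; rewrite -normc_gt0; lra.
have [M1 HM1] := mean_log_derivative_cvg _ _ _ r0 e2 (root_off _ _ p0).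
have [M2 HM2] := mean_log_derivative_cvg _ _ _ r0 e2 (root_off _ _ q0).
pose M := (maxn M1 M2).+1.
have [z pz] := @exists_prim_root R M isT.
have {HM1}h1 := HM1 M z (leqW (leq_maxl _ _)) pz.
have {HM2}h2 := HM2 M z (leqW (leq_maxr _ _)) pz.
rewrite -normc_real rmorphB !rmorph_nat.
set A := _ * _ in h1; set A' := _ * _ in h2.
set N := _%:R in h1 *; set N' := _%:R in h2 *.
have -> : N - N' = (A' - N') - (A - N) + (A - A') by ring.
suff h3 : normc (A - A') <= r * L / delta ^+ 2.
  rewrite (le_trans (le_normcD _ _))// addrC lerD// (le_trans (le_normcD _ _))//.
  by rewrite normcN [X in _ <= X]splitr lerD.
rewrite /A /A' -mulrBr -sumrB normcM normcV normc_nat ler_pdivrMl ?ltr0n//.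
rewrite (le_trans (normc_sum _ _ _ _))//.
rewrite mulr_natl -[X in _ <= _ *+ X](card_ord M) -sumr_const.
apply: ler_sum => k _; rewrite -!mulr_sumr.
set w := r%:C * z ^+ k.
have wr : normc w = r.
  rewrite normcM normc_real gtr0_norm// (@normc_unity_root _ M) ?mulr1//.
  by rewrite -exprM mulnC exprM (prim_expr_order pz) expr1n.
rewrite -(log_derivative_prod_XsubC _ _ _ (p0 _ wr)).
rewrite -(log_derivative_prod_XsubC _ _ _ (q0 _ wr)).
rewrite -/p -/q -mulrBr normcM wr -mulrA.
rewrite ler_pM2l// (_ : _ - _ = (p^`() * q - p * q^`()).[w] / (p.[w] * q.[w])).
  have [h1' h2' h3'] := H _ wr.
  rewrite normc_div ler_pM ?invr_ge0 ?normc_ge0// normcM.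
  rewrite lef_pV2 ?posrE ?exprn_gt0 ?mulr_gt0 ?normc_gt0 ?p0 ?q0//.
  by rewrite expr2 ler_pM// ltW.
by rewrite hornerD hornerN !hornerM; field; rewrite p0 ?q0.
Qed.

End CountingRoots.

(** * Rouche's theorem for polynomials *)

Section PolynomialRouche.
Context {R : realType}.
Implicit Types (p q : {poly R[i]}) (s t : seq R[i]) (r : R).

(* The factor a - b makes the number of roots Lipschitz along the pencil. *)
Lemma wronskian_pencil q h (a b : R[i]) :
  (q + a *: h)^`() * (q + b *: h) - (q + a *: h) * (q + b *: h)^`()
  = (a - b) *: (h^`() * q - h * q^`()).
Proof. by rewrite !derivD !derivZ -!mul_polyC polyCB; ring. Qed.

Lemma poly_rouche (c d : R[i]) s t (r delta : R) :
  let p := c *: \prod_(a <- s) ('X - a%:P) in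
  let q := d *: \prod_(a <- t) ('X - a%:P) in
  0 < r -> 0 < delta ->
  (forall z, normc z = r -> normc (p.[z] - q.[z]) + delta <= normc q.[z]) ->
  count (fun a => normc a < r) s = count (fun a => normc a < r) t.
Proof.
move=> p q; have Ep : p = c *: \prod_(a <- s) ('X - a%:P) by [].
have Eq : q = d *: \prod_(a <- t) ('X - a%:P) by [].
clearbody p q => r0 d0 pq; pose h := p - q; pose W := h^`() * q - h * q^`().
pose P (x : R) : {poly R[i]} := q + x%:C *: h.
have WP x y : (P x)^`() * P y - P x * (P y)^`() = (x - y)%:C *: W.
  by rewrite /P rmorphB wronskian_pencil.
(* The lower bound persists along the whole segment, because [|q + x (p - q)| >= |q| - |p - q|] for
   [x] in [[0, 1]]. *)
have Pge x z : 0 <= x <= 1 -> normc z = r -> delta <= normc (P x).[z].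
  move=> /andP[x0 x1] zr; have := pq z zr.
  have -> : (P x).[z] = q.[z] - - (x%:C * (p.[z] - q.[z])).
    by rewrite opprK hornerD hornerZ /h hornerD hornerN.
  have := ler_normc_sub q.[z] (- (x%:C * (p.[z] - q.[z]))).
  rewrite normcN normcM normc_real ger0_norm//.
  have := ler_wpM2r (normc_ge0 (p.[z] - q.[z])) x1.
  by rewrite mul1r; lra.
have [C C0 HC] := poly_bounded_disk W r.
have P1 : P 1 = p by rewrite /P scale1r addrC subrK.
have P0 : P 0 = q by rewrite /P scale0r addr0.
have step x y (c1 c2 : R[i]) s1 s2 : 0 <= x <= 1 -> 0 <= y <= 1 ->
    r * (`|x - y| * C) / delta ^+ 2 < 1 ->
    P x = c1 *: \prod_(a <- s1) ('X - a%:P) ->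
    P y = c2 *: \prod_(a <- s2) ('X - a%:P) ->
    count (fun a => normc a < r) s1 = count (fun a => normc a < r) s2.
  move=> x01 y01 xy Px Py.
  have := @count_roots_dist R c1 c2 s1 s2 r delta (`|x - y| * C) r0 d0.
  rewrite -Px -Py => /(_ _)/le_lt_trans/(_ xy) H.
  have {}H : `|(count (fun a => (normc a < r)%R) s1)%:R -
      (count (fun a => (normc a < r)%R) s2)%:R| < 1 :> R.
    apply: H => z zr; split; [exact: Pge|exact: Pge|].
    by rewrite WP hornerZ normcM normc_real ler_wpM2l// HC ?zr.
  apply/eqP; move: H.
  set m := count _ s1; set n := count _ s2.
  rewrite eqn_leq ltr_norml -!(ltnS m) -(ltnS n) -!(ltr_nat R) -!natr1.
  by move=> /andP[h1 h2]; apply/andP; split; lra.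
(* With [K] equal steps, each changes the count by at most [(r * C / delta ^+ 2) / K < 1]; an
   integer moving by less than 1 is constant. *)
pose K := (Num.truncn (r * C / delta ^+ 2)).+1.
have KC : r * C / delta ^+ 2 < K%:R by apply: truncnS_gt.
have K0 : 0 < K%:R :> R by rewrite ltr0n.
have xi i : (i <= K)%N -> 0 <= (i%:R / K%:R : R) <= 1.
  by move=> iK; rewrite divr_ge0 ?ler0n//= ler_pdivrMr// mul1r ler_nat.
have iter i (c1 : R[i]) s1 : (i <= K)%N -> P (i%:R / K%:R) = c1 *: \prod_(a <- s1) ('X - a%:P) ->
    count (fun a => normc a < r) s1 = count (fun a => normc a < r) t.
  elim: i c1 s1 => [|i IH] c1 s1 iK Ps1.
    apply: (step 0 0 c1 d) => //; rewrite ?ler01 ?lexx//.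
    - by rewrite subrr normr0 mul0r mulr0 mul0r.
    - by rewrite -Ps1 mul0r.
    - by rewrite P0.
  have [s2 Ps2] := closed_field_poly_normal (P (i%:R / K%:R)).
  rewrite -(IH _ _ (ltnW iK) Ps2); apply: (step _ _ _ _ _ _ _ _ _ Ps1 Ps2).
  - exact: xi.
  - exact/xi/ltnW.
  - rewrite -mulrBl -natr1 addrAC subrr add0r mul1r ger0_norm ?invr_ge0 ?ler0n//.
    rewrite (_ : _ / _ = (r * C / delta ^+ 2) / K%:R); last first.
      by field; rewrite (gt_eqF K0) (gt_eqF d0).
    by rewrite ltr_pdivrMr// mul1r.
by apply: (iter K c) => //; rewrite divff ?P1// gt_eqF.
Qed.

End PolynomialRouche.

(** * Entire functions *)

Section PolynomialLimits.
Context {R : realType}.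
Implicit Types (p q : {poly R[i]}) (f g : R[i] -> R[i]).

(* Equivalent to holomorphy on the whole plane; with this definition, both the
   division by z - z0 and Rouche's theorem reduce to polynomials. *)
Definition entire f : Prop := forall r e : R, 0 < e ->
  exists p : {poly R[i]}, forall z, normc z <= r -> normc (f z - p.[z]) <= e.

Lemma entire_poly p : entire (horner p).
Proof. by move=> r e e0; exists p => z _; rewrite subrr normc0 ltW. Qed.

Lemma entire_cst (c : R[i]) : entire (fun=> c).
Proof.
by rewrite (_ : (fun=> c) = horner c%:P); [exact: entire_poly|apply/funext => z; rewrite hornerC].
Qed.

Lemma entireD f g : entire f -> entire g -> entire (fun z => f z + g z).
Proof.
move=> hf hg r e e0; have e2 : 0 < e / 2 by lra.
have [p fp] := hf r _ e2; have [q gq] := hg r _ e2.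
exists (p + q) => z zr; rewrite hornerD opprD addrACA [e]splitr.
by rewrite (le_trans (le_normcD _ _))// lerD ?fp ?gq.
Qed.

Lemma entireZ (c : R[i]) f : entire f -> entire (fun z => c * f z).
Proof.
move=> hf r e e0; have c1 : 0 < normc c + 1 by rewrite ltr_wpDl ?normc_ge0.
have [|p fp] := hf r (e / (normc c + 1)); first by rewrite divr_gt0.
exists (c *: p) => z zr; rewrite hornerZ -mulrBr normcM.
have := fp z zr; rewrite ler_pdivlMr// mulrDr mulr1 [normc c * _]mulrC => h.
by apply: le_trans h; rewrite lerDl normc_ge0.
Qed.

Lemma entire_scale (c : R[i]) f : entire f -> entire (fun z => f (c * z)).
Proof.
move=> hf r e e0; have [p fp] := hf (normc c * r) e e0.
exists (p \Po (c *: 'X)) => z zr; rewrite horner_comp hornerZ hornerX.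
by apply: fp; rewrite normcM ler_wpM2l ?normc_ge0.
Qed.

Lemma entireMpoly p f : entire f -> entire (fun z => p.[z] * f z).
Proof.
move=> hf r e e0; have [C C0 HC] := poly_bounded_disk p r.
have [|q Hq] := hf r (e / C); first by rewrite divr_gt0.
exists (p * q) => z zr; rewrite hornerM -mulrBr normcM.
have := Hq z zr; rewrite ler_pdivlMr// mulrC; apply: le_trans.
by rewrite ler_wpM2r ?normc_ge0// HC.
Qed.

Lemma entire_bounded_disk (f : R[i] -> R[i]) (r : R) : entire f ->
  exists2 C : R, 0 < C & forall z, normc z <= r -> normc (f z) <= C.
Proof.
move=> /(_ r 1 ltr01)[p Hp]; have [C C0 HC] := poly_bounded_disk p r.
exists (1 + C) => [|z zr]; first by rewrite addr_gt0.
have := le_normcD (f z - p.[z]) p.[z]; rewrite subrK.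
by have := Hp _ zr; have := HC _ zr; lra.
Qed.

Lemma poly_sub_factor p (z0 : R[i]) :
  exists q, forall z, p.[z] - p.[z0] = (z - z0) * q.[z].
Proof.
have /factor_theorem[q Eq] : root (p - (p.[z0])%:P) z0.
  by rewrite /root hornerD hornerN hornerC subrr.
exists q => z; have := congr1 (horner^~ z) Eq.
by rewrite hornerD hornerN hornerC hornerM hornerXsubC mulrC.
Qed.

Lemma entire_continuous f z (e : R) : entire f -> 0 < e ->
  exists2 d : R, 0 < d & forall w, normc (w - z) <= d -> normc (f w - f z) <= e.
Proof.
move=> hf e0; have e3 : 0 < e / 3 by lra.
have [p fp] := hf (normc z + 1) _ e3.
have [q Eq] := poly_sub_factor p z.
have [C C0 qC] := poly_bounded_disk q (normc z + 1).
exists (Num.min 1 (e / 3 / C)); first by rewrite lt_min ltr01 divr_gt0.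
move=> w; rewrite le_min ler_pdivlMr// => /andP[w1 wC].
have wz : normc w <= normc z + 1 by have := ler_normc_sub w z; lra.
have -> : f w - f z = (f w - p.[w]) + (p.[w] - p.[z]) + (p.[z] - f z) by ring.
rewrite (le_trans (le_normcD _ _))// (le_trans (lerD (le_normcD _ _) (lexx _)))//.
have h1 := fp _ wz; have h2 : normc (p.[z] - f z) <= e / 3.
  by rewrite normcB fp// lerDl.
have h3 : normc (p.[w] - p.[z]) <= e / 3.
  rewrite Eq normcM; apply: le_trans wC; rewrite ler_wpM2l ?normc_ge0//.
  exact: qC.
lra.
Qed.

(** Helly's theorem on the line: the intervals of centre [a n] and radius [e n] meet pairwise, and
    the supremum of their left endpoints lies in all of them. The index set [P] accommodates
    approximations that are valid on growing discs only. *)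
Lemma nested_intervals (P : set nat) (a e : nat -> R) :
  P !=set0 -> (forall n m, P n -> P m -> `|a n - a m| <= e n + e m) ->
  exists l, forall n, P n -> `|l - a n| <= e n.
Proof.
move=> [n0 Pn0] H; pose E := [set a n - e n | n in P].
have ubE m : P m -> ubound E (a m + e m).
  by move=> Pm _ [n Pn <-]; have := H n m Pn Pm; rewrite ler_norml; lra.
exists (sup E) => n Pn; rewrite ler_norml; apply/andP; split.
  suff : a n - e n <= sup E by lra.
  by apply: ub_le_sup; [exists (a n + e n); exact: ubE|exists n].
suff : sup E <= a n + e n by lra.
by apply: ge_sup; [exists (a n0 - e n0); exists n0|exact: ubE].
Qed.

Lemma nested_disks (P : set nat) (u : nat -> R[i]) (e : nat -> R) :
  P !=set0 -> (forall n m, P n -> P m -> normc (u n - u m) <= e n + e m) ->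
  exists l, forall n, P n -> normc (l - u n) <= 2 * e n.
Proof.
move=> P0 H.
have [|x Hx] := @nested_intervals P (fun n => complex.Re (u n)) e P0.
  move=> n m Pn Pm; apply: le_trans (H _ _ Pn Pm); apply: le_trans (normc_Re _).
  by rewrite raddfB.
have [|y Hy] := @nested_intervals P (fun n => complex.Im (u n)) e P0.
  move=> n m Pn Pm; apply: le_trans (H _ _ Pn Pm); apply: le_trans (normc_Im _).
  by rewrite raddfB.
exists (x +i* y) => n Pn; apply: le_trans (normc_leReIm _) _.
rewrite !raddfB /= mulr_natl mulr2n lerD ?Hx ?Hy//.
Qed.

(** The approximants [p n] of [f] need not vanish at [z0], so [p n - (p n).[z0]] is divided instead;
    the correction is at most [e n] because [f z0 = 0]. The quotient is the pointwise limit of the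
    [q n]. *)
Lemma entire_div f z0 : entire f -> f z0 = 0 ->
  exists2 g, entire g & forall z, f z = (z - z0) * g z.
Proof.
move=> hf f0; pose r n : R := normc z0 + n.+1%:R; pose e n : R := n.+1%:R^-1.
have e0 n : 0 < e n by rewrite invr_gt0 ltr0n.
have r0 n : 0 < r n by rewrite ltr_wpDl ?normc_ge0// ltr0n.
have [p Hp] := boolp.choice (fun n => hf (2 * r n) (e n) (e0 n)).
have [q Hq] := boolp.choice (fun n => poly_sub_factor (p n) z0).
(* The quotients q n are uniformly Cauchy: compare them on the circle of radius
   2 r n, where |z - z0| >= 1. *)
have z0r n : normc z0 <= 2 * r n.
  by have := r0 n; rewrite /r; have := normc_ge0 z0; have := ler0n R n.+1; lra.
have qC n m z : (n <= m)%N -> normc z <= r n ->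
    normc ((q n).[z] - (q m).[z]) <= 4 * e n + 4 * e m.
  move=> nm zr; rewrite -hornerN -hornerD.
  rewrite (_ : _ + _ = 2 * (2 * e n + 2 * e m)); last by ring.
  apply: (@poly_le_half_disk _ _ (r n)) zr => // {}z zr.
  have zz0 : 1 <= normc (z - z0).
    have := ler_normc_sub z z0; rewrite zr /r.
    have : 1 <= n.+1%:R :> R by rewrite ler1n.
    by have := normc_ge0 z0; lra.
  have rm : r n <= r m by rewrite lerD2l ler_nat.
  have h1 := Hp n z; have h2 := Hp m z.
  have h3 := Hp n z0 (z0r _); have h4 := Hp m z0 (z0r _).
  rewrite f0 sub0r normcN in h3; rewrite f0 sub0r normcN in h4.
  have {}h1 : normc (f z - (p n).[z]) <= e n by apply: h1; rewrite zr.
  have {}h2 : normc (f z - (p m).[z]) <= e m by apply: h2; rewrite zr; lra.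
  have : normc ((z - z0) * (q n - q m).[z]) <= 2 * e n + 2 * e m.
    rewrite hornerD hornerN mulrBr -!Hq.
    rewrite (_ : _ - _ = (f z - (p m).[z]) - (f z - (p n).[z])
        + ((p m).[z0] - (p n).[z0])); last by ring.
    rewrite (le_trans (le_normcD _ _))//.
    have := le_normcD (f z - (p m).[z]) (- (f z - (p n).[z])).
    have := le_normcD (p m).[z0] (- (p n).[z0]).
    rewrite !normcN; lra.
  rewrite normcM; apply: le_trans.
  by rewrite ler_peMl ?normc_ge0.
have Pz z : [set n | normc z <= r n] !=set0.
  exists (Num.truncn (normc z)); rewrite /= /r.
  by rewrite ler_wpDl ?normc_ge0// ltW// truncnS_gt.
have /boolp.choice[g Hg] z : exists l, forall n, normc z <= r n ->
    normc (l - (q n).[z]) <= 2 * (4 * e n).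
  apply: nested_disks (Pz z) _ => n m zn zm.
  have [nm|/ltnW mn] := leqP n m; first exact: qC.
  by rewrite normcB [X in _ <= X]addrC; exact: qC.
exists g.
  move=> b d d0; pose n := Num.truncn (Num.max b (8 / d)).
  have nb : Num.max b (8 / d) < n.+1%:R by apply: truncnS_gt.
  exists (q n) => z zb; apply: le_trans (Hg _ _ _) _.
    rewrite (le_trans zb)// /r ler_wpDl ?normc_ge0// ltW// (le_lt_trans _ nb)//.
    by rewrite le_max lexx.
  rewrite mulrA (_ : 2 * 4 = 8 :> R); last by lra.
  rewrite /e ler_pdivrMr ?ltr0n// mulrC -ler_pdivrMr//.
  by rewrite ltW// (le_lt_trans _ nb)// le_max lexx orbT.
move=> z; apply/subr0_eq/eqP; rewrite -normc_eq0 eq_le normc_ge0 andbT.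
apply/ler_addgt0Pr => d d0; rewrite add0r.
(* The [2] counts the errors of [p n] at [z] and at [z0]; the other term is the error of [q n]
   multiplied by [|z - z0|]. *)
pose C := 2 + 8 * normc (z - z0); have C0 : 0 < C.
  by rewrite ltr_pwDl// mulr_ge0 ?normc_ge0.
pose n := Num.truncn (Num.max (normc z) (C / d)).
have nb : Num.max (normc z) (C / d) < n.+1%:R by apply: truncnS_gt.
have zr : normc z <= r n.
  by rewrite /r ler_wpDl ?normc_ge0// ltW// (le_lt_trans _ nb)// le_max lexx.
have ze : C * e n <= d.
  rewrite /e ler_pdivrMr ?ltr0n// mulrC -ler_pdivrMr//.
  by rewrite ltW// (le_lt_trans _ nb)// le_max lexx orbT.
apply: le_trans ze; rewrite (_ : _ - _ = (f z - (p n).[z]) + (p n).[z0]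
   + (z - z0) * ((q n).[z] - g z)); last first.
  by rewrite mulrBr -Hq; ring.
have h1 : normc (f z - (p n).[z]) <= e n.
  by apply: Hp; apply: le_trans zr _; have := r0 n; lra.
have h2 := Hp n z0 (z0r _); rewrite f0 sub0r normcN in h2.
have h3 : normc ((z - z0) * ((q n).[z] - g z)) <= 8 * normc (z - z0) * e n.
  rewrite normcM mulrAC [_ * normc (z - z0)]mulrC ler_wpM2l ?normc_ge0// normcB.
  by apply: le_trans (Hg _ _ zr) _; lra.
have -> : C * e n = e n + e n + 8 * normc (z - z0) * e n by rewrite /C; ring.
by rewrite (le_trans (le_normcD _ _))// lerD// (le_trans (le_normcD _ _))// lerD.
Qed.

End PolynomialLimits.

(** * Derivatives and minimum modulus of entire functions *)

Section EntireZeros.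
Context {R : realType}.
Implicit Types (p q : {poly R[i]}) (f g : R[i] -> R[i]).

Lemma nbhs_normc (z : R[i]^o) (e : R) : 0 < e ->
  \forall w \near z, normc (w - z) < e.
Proof.
move=> e0; have /nbhs_ballP : nbhs z (ball z e%:C).
  by apply: nbhsx_ballx; rewrite ltcR.
move=> [d /= d0 H]; exists d => // w /H; rewrite /ball /= normCE ltcR normcB.
exact.
Qed.

(** Dividing [f - f z] by [w - z] leaves an entire [g] that is the difference quotient; its
    continuity at [z] gives the derivative [g z]. *)
Lemma entire_derivable f z : entire f -> derivable (f : R[i]^o -> R[i]^o) z 1.
Proof.
move=> hf.
have [g hg fg] : exists2 g, entire g & forall w, f w - f z = (w - z) * g w.
  by apply: entire_div; rewrite ?subrr//; apply/(entireD f)/entire_cst.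
apply/cvg_ex; exists (g z); apply/cvgrPdist_le => /= e e0.
have [d d0 H] : exists2 d : R, 0 < d &
    forall w, normc (w - z) <= d -> normc (g w - g z) <= complex.Re e.
  by apply: entire_continuous => //; move: e0; rewrite ltcE => /andP[].
rewrite near_withinE; apply: filterS (nbhs_normc 0 d d0) => t.
rewrite subr0 => /ltW td t0; rewrite fg addrK -(RRe_real (gtr0_real e0)).
rewrite /GRing.scale /= mulr1 mulKf// normCE lecR normcB; apply: H.
by rewrite addrK.
Qed.

(** The extreme value theorem, applied to the disc seen in [R * R], where it is closed in a compact
    square. *)
Lemma entire_min_disk f r : entire f -> 0 <= r ->
  (forall z, normc z <= r -> f z != 0) ->
  exists2 d : R, 0 < d & forall z, normc z <= r -> d <= normc (f z).
Proof.
move=> hf r0 fz.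
pose A := [set x : R * R | normc (x.1 +i* x.2) <= r].
have cA : compact A.
  apply: (@subclosed_compact _ A (`[-r, r] `*` `[-r, r])).
  - have -> : A = (fun x : R * R => Num.sqrt (x.1 ^+ 2 + x.2 ^+ 2)) @^-1` [set x | x <= r] by [].
    apply: closed_comp; last exact: closed_le.
    move=> x _; apply: (@continuous_comp _ _ _ (fun x : R * R => x.1 ^+ 2 + x.2 ^+ 2)).
      by apply: cvgD; apply: (@continuous_comp _ _ _ _ (@GRing.exp R ^~ 2%N));
        [exact: cvg_fst|exact: exprn_continuous|exact: cvg_snd|exact: exprn_continuous].
    exact: sqrt_continuous.
  - by apply: compact_setX; exact: segment_compact.
  - move=> [x y] /= xy; split; rewrite /= in_itv /= -ler_norml.
    + exact: le_trans (normc_Re (x +i* y)) xy.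
    + exact: le_trans (normc_Im (x +i* y)) xy.
have A0 : A !=set0 by exists (0, 0); rewrite /A /= expr0n addr0 sqrtr0.
have cf : {within A, continuous (fun x : R * R => normc (f (x.1 +i* x.2)))}.
  apply: continuous_subspaceT => -[x y]; apply/cvgrPdist_le => /= e e0.
  have [d d0 H] := entire_continuous f (x +i* y) e hf e0.
  have d2 : 0 < d / 2 by lra.
  exists (ball x (d / 2), ball y (d / 2)) => /=.
    by split; exact: nbhsx_ballx.
  move=> [x' y'] /= [hx hy].
  rewrite ler_norml; have : normc (f (x' +i* y') - f (x +i* y)) <= e.
    apply: H; apply: (le_trans (normc_leReIm _)); rewrite /= [d]splitr.
    by rewrite lerD// distrC ltW.
  have := ler_normc_sub (f (x' +i* y')) (f (x +i* y)).
  have := ler_normc_sub (f (x +i* y)) (f (x' +i* y')).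
  by rewrite (normcB (f (x +i* y))); lra.
have [[x y] xyA H] := compact_EVT_min A0 cA cf.
exists (normc (f (x +i* y))).
  by rewrite normc_gt0 fz//; move: xyA; rewrite inE.
by case=> a b ab; apply: (H (a, b)); rewrite inE.
Qed.

End EntireZeros.

(** * Factoring out zeros, and Rouche's theorem for entire functions *)

Section EntireRouche.
#[local] Set Implicit Arguments.
#[local] Unset Strict Implicit.
Context {R : realType}.
Implicit Types (p q : {poly R[i]}) (f g : R[i] -> R[i]) (s t : seq R[i]) (r : R).

Local Notation prodX s := (\prod_(a <- s) ('X - a%:P)).

(** A partial factorization: [g] may still vanish in the disc, so that zeros can be removed one at a
    time. *)
Definition zeros_factored r f s g :=
  [/\ entire g, forall z, f z = (prodX s).[z] * g z &
      {in s, forall a, normc a < r}].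

(** Approximating the cofactor rather than [f] keeps the zeros in [s] as exact roots of the
    approximating polynomial. *)
Lemma entire_factor_approx r f s g (e : R) (d : R) :
  zeros_factored r f s g -> 0 < e -> 0 < d ->
  exists q, forall z, normc z <= r ->
    normc (f z - (prodX s * q).[z]) <= e /\ normc (g z - q.[z]) <= d.
Proof.
move=> [hg fg _] e0 d0.
have [C C0 HC] := poly_bounded_disk (prodX s) r.
have m0 : 0 < Num.min d (e / C) by rewrite lt_min d0 divr_gt0.
have [q Hq] := hg r _ m0.
exists q => z zr; have := Hq z zr; rewrite le_min => /andP[h1 h2]; split => //.
rewrite fg hornerM -mulrBr normcM; move: h2; rewrite ler_pdivlMr// mulrC.
by apply: le_trans; rewrite ler_wpM2r ?normc_ge0// HC.
Qed.

Lemma roots_prodX_mul s q : exists t (c : R[i]),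
  [/\ q = c *: prodX t, prodX s * q = c *: prodX (s ++ t) &
      forall z, q.[z] != 0 -> z \notin t].
Proof.
have [t Et] := closed_field_poly_normal q.
exists t, (lead_coef q); split => //.
  by rewrite big_cat /= {1}Et -scalerAr.
move=> z; apply: contraNN => zt; rewrite Et hornerZ mulf_eq0; apply/orP; right.
by rewrite -/(root _ z) root_prod_XsubC.
Qed.

(** One fixed polynomial [p] close to [f] bounds every factorization: [prodX s * q] is close to [p]
    on the circle, so it has as many roots inside as [p], and those in [s] are among them. *)
Lemma entire_zeros_bounded f r (delta : R) : 0 < r -> 0 < delta ->
  entire f -> (forall z, normc z = r -> delta <= normc (f z)) ->
  exists n, forall s g, zeros_factored r f s g -> (size s <= n)%N.
Proof.
move=> r0 d0 hf fd; have d4 : 0 < delta / 4 by lra.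
have [p Hp] := hf r _ d4; have [t Et] := closed_field_poly_normal p.
exists (size t) => s g sg; have [q Hq] := entire_factor_approx sg d4 ltr01.
have [t' [c [_ Eq _]]] := roots_prodX_mul s q.
(* On the circle [|p|] is at least [3/4] of [delta] and the two approximations differ by at most
   [delta / 2], which leaves a margin [delta / 4]. *)
have := @poly_rouche R c (lead_coef p) (s ++ t') t r (delta / 4) r0 d4.
rewrite -Eq -Et count_cat => /(_ _)H.
have {}H : (count (fun a => (normc a < r)%R) s + count (fun a => (normc a < r)%R) t' =
    count (fun a => (normc a < r)%R) t)%N.
  apply: H => z zr; have h1 := fd z zr.
  have zr' : normc z <= r by rewrite zr.
  have [h2 _] := Hq z zr'; have h3 := Hp z zr'.
  have h4 := ler_normc_dist (f z) p.[z].
  rewrite (_ : _ - _ = (f z - p.[z]) - (f z - (prodX s * q).[z])); last by ring.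
  have := le_normcD (f z - p.[z]) (- (f z - (prodX s * q).[z])).
  by rewrite normcN; lra.
have sr : count (fun a => (normc a < r)%R) s = size s.
  by apply/eqP; rewrite -all_count; apply/allP; case: sg.
have := count_size (fun a => (normc a < r)%R) t; rewrite -H -sr.
by apply: leq_trans; exact: leq_addr.
Qed.

Lemma zeros_factored_cons r (delta : R) f s g z : 0 < delta ->
  (forall z, normc z = r -> delta <= normc (f z)) ->
  normc z <= r -> g z = 0 -> zeros_factored r f s g ->
  exists h, zeros_factored r f (z :: s) h.
Proof.
move=> d0 fd zr gz [hg fg sr]; have [h hh gh] := entire_div g z hg gz.
exists h; split => // [w|a].
  by rewrite fg gh big_cons hornerM hornerXsubC mulrA [_ * (w - z)]mulrC.
rewrite inE => /predU1P[->|/sr//]; rewrite lt_neqAle zr andbT.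
by apply/eqP => /fd; rewrite fg gz mulr0 normc0 leNgt d0.
Qed.

(** Zeros are divided out until none remains in the closed disc. The bound [n] on their number makes
    this stop: [k] is the number of divisions still allowed. *)
Lemma entire_factorization f r (delta : R) : 0 < r -> 0 < delta ->
  entire f -> (forall z, normc z = r -> delta <= normc (f z)) ->
  exists s g, zeros_factored r f s g /\ forall z, normc z <= r -> g z != 0.
Proof.
move=> r0 d0 hf fd; have [n Hn] := entire_zeros_bounded r0 d0 hf fd.
have IH k : forall s g, (n <= size s + k)%N -> zeros_factored r f s g ->
    exists s g, zeros_factored r f s g /\ forall z, normc z <= r -> g z != 0.
  elim: k => [|k IH] s g nk sg;
    have [[z zr gz]|gn] := pselect (exists2 z, normc z <= r & g z = 0).
  - have [h sh] := zeros_factored_cons d0 fd zr gz sg.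
    by have := Hn _ _ sh; rewrite /= ltnNge -(addn0 (size s)) nk.
  - exists s, g; split => // z zr; apply/eqP => gz; apply: gn; by exists z.
  - have [h sh] := zeros_factored_cons d0 fd zr gz sg.
    by apply: IH sh; rewrite /= addSnnS.
  - exists s, g; split => // z zr; apply/eqP => gz; apply: gn; by exists z.
apply: (IH n [::] f) => //; split => // z.
by rewrite big_nil hornerC mul1r.
Qed.

(** Each function is replaced by a polynomial with the same number of roots in the disc: the
    cofactor is at least some [e] there, so an approximation of it within [e / 2] has no root
    there. *)
Lemma entire_rouche f g s t f1 g1 r (delta : R) : 0 < r -> 0 < delta ->
  zeros_factored r f s f1 -> (forall z, normc z <= r -> f1 z != 0) ->
  zeros_factored r g t g1 -> (forall z, normc z <= r -> g1 z != 0) ->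
  (forall z, normc z = r -> normc (f z - g z) + delta <= normc (g z)) ->
  size s = size t.
Proof.
move=> r0 d0 fs f10 gt g10 fg; have d4 : 0 < delta / 4 by lra.
have approx h u h1 : zeros_factored r h u h1 -> (forall z, normc z <= r -> h1 z != 0) ->
    exists (c : R[i]) v,
    [/\ forall z, normc z <= r -> normc (h z - (c *: prodX v).[z]) <= delta / 4 &
        count (fun a => (normc a < r)%R) v = size u].
  move=> hu h0; have [e1 _ _] := hu.
  have [e e0 He] := entire_min_disk h1 r e1 (ltW r0) h0.
  have e2 : 0 < e / 2 by lra.
  have [q Hq] := entire_factor_approx hu d4 e2.
  have [v [c [_ Ev qv]]] := roots_prodX_mul u q.
  exists c, (u ++ v); split; first by move=> z zr; rewrite -Ev; case: (Hq z zr).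
  rewrite count_cat -[RHS]addn0; congr (_ + _)%N.
    by apply/eqP; rewrite -all_count; apply/allP; case: hu.
  apply/eqP; rewrite -leqn0 leqNgt -has_count; apply/hasPn => a av.
  apply/negP => /= ar; suff : a \notin v by rewrite av.
  apply: qv; have h1a := He _ (ltW ar); have [_ h2a] := Hq _ (ltW ar).
  rewrite -normc_gt0; have := ler_normc_dist (h1 a) q.[a]; lra.
have [c [s' [Hs <-]]] := approx _ _ _ fs f10.
have [d [t' [Ht <-]]] := approx _ _ _ gt g10.
apply: (@poly_rouche R c d s' t' r (delta / 4)) => // z zr.
have zr' : normc z <= r by rewrite zr.
have h1 := fg z zr; have h2 := Ht z zr'; have h3 := Hs z zr'.
set P := (c *: _).[z] in h3 *; set Q := (d *: _).[z] in h2 *.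
have := ler_normc_dist (g z) Q.
have -> : P - Q = (f z - g z) + (g z - Q) - (f z - P) by ring.
have := le_normcD ((f z - g z) + (g z - Q)) (- (f z - P)).
have := le_normcD (f z - g z) (g z - Q).
by rewrite normcN; lra.
Qed.

Lemma prodX_count s z : prodX s =
  ('X - z%:P) ^+ count_mem z s * \prod_(a <- s | a != z) ('X - a%:P).
Proof.
rewrite (bigID (pred1 z)) /=; congr (_ * _).
elim: s => [|a s IH] /=; first by rewrite big_nil.
by rewrite big_cons IH; case: eqVneq => [->|_]; rewrite ?exprS ?add0n.
Qed.

Lemma vanishing_factor r f s g z : zeros_factored r f s g ->
  exists2 h, entire h & forall w, f w = (w - z) ^+ count_mem z s * h w.
Proof.
move=> [hg fg _]; pose p := \prod_(a <- s | a != z) ('X - a%:P).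
exists (fun w => p.[w] * g w); first exact: entireMpoly.
by move=> w; rewrite fg (prodX_count s z) hornerM horner_exp hornerXsubC mulrA.
Qed.

(** The factors [w - a] with [a != z] join [g] in the local cofactor, which stays nonzero at [z]. *)
Lemma vanishing_order_factor r f s g z : zeros_factored r f s g -> g z != 0 ->
  vanishing_order f z (count_mem z s).
Proof.
move=> [hg fg _] gz; pose p := \prod_(a <- s | a != z) ('X - a%:P).
exists (fun w => p.[w] * g w); split.
- by apply: filterE => w; exact/entire_derivable/entireMpoly.
- apply: filterE => w.
  by rewrite fg (prodX_count s z) hornerM horner_exp hornerXsubC mulrA.
- rewrite mulf_neq0// /p horner_prod prodf_seq_neq0; apply/allP => a _.
  by apply/implyP => az; rewrite hornerXsubC subr_eq0 eq_sym.
Qed.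

End EntireRouche.

(** * The complex exponential *)

Section RealEstimates.
Context {R : realType}.
Implicit Types a b x : R.

(** Both bounds come from [1 + x <= expR x], at [a] and at [- a]; the second reads
    [(1 - a) * expR a <= 1], and [1 - a >= 1/2] yields the constant 2. *)
Lemma expR_taylor1 a : `|a| <= 2^-1 -> 0 <= expR a - 1 - a <= 2 * a ^+ 2.
Proof.
rewrite ler_norml => /andP[a1 a2]; have := expR_ge1Dx a.
have h : (1 - a) * expR a <= 1.
  have := ler_wpM2r (expR_ge0 a) (expR_ge1Dx (- a)).
  by rewrite -expRD addNr expR0.
move=> h1; apply/andP; split; first lra.
have : (1 - a) * (expR a - 1 - a) <= a ^+ 2.
  by rewrite !mulrBr expr2 mulr1; lra.
have : 0 <= expR a - 1 - a by lra.
set X := _ - a; nra.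
Qed.

Lemma sin_le_norm x : `|sin x| <= `|x|.
Proof.
wlog x0 : x / 0 <= x => [H|].
  have [/H//|/ltW x0] := leP 0 x; rewrite -normrN -sinN -[`|x|]normrN.
  by apply: H; rewrite oppr_ge0.
have [|c _] := @MVT_segment R sin cos 0 x x0 (fun y _ => is_derive_sin y).
  by apply: continuous_subspaceT => y; exact: continuous_sin.
by rewrite sin0 !subr0 => ->; rewrite normrM ler_piMl ?normr_ge0// cos_max.
Qed.

Lemma cos_taylor0 x : 0 <= 1 - cos x <= x ^+ 2.
Proof.
rewrite subr_ge0 cos_le1 /=.
have -> : 1 - cos x = 2 * sin (x / 2) ^+ 2.
  have {1}-> : x = (x / 2) *+ 2 by rewrite -mulr_natr divfK.
  by rewrite cos_mulr2n sin2cos2 mulr2n; ring.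
have := sin_le_norm (x / 2); rewrite -(ler_pXn2r (_ : 0 < 2)%N) ?nnegrE//.
by rewrite !real_normK ?num_real//; nra.
Qed.

Lemma sin_taylor1 x : `|x| <= 1 -> `|sin x - x| <= x ^+ 2.
Proof.
wlog x0 : x / 0 <= x => [H|].
  have [/H//|/ltW x0 x1] := leP 0 x.
  have -> : sin x - x = - (sin (- x) - - x) by rewrite sinN; ring.
  by rewrite normrN -sqrrN; apply: H; rewrite ?oppr_ge0 ?normrN.
rewrite ger0_norm// => x1.
have [|c] := @MVT_segment R sin cos 0 x x0 (fun y _ => is_derive_sin y).
  by apply: continuous_subspaceT => y; exact: continuous_sin.
rewrite sin0 !subr0 in_itv /= => /andP[c0 cx] ->.
have /andP[] := cos_taylor0 c; rewrite ler_norml; nra.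
Qed.

End RealEstimates.

(** * Functional equation, modulus and polynomial approximation *)

Section ComplexExponential.
Context {R : realType}.
Implicit Types (u v w z : R[i]).

Lemma cexpD u v : cexp (u + v) = cexp u * cexp v.
Proof.
case: u v => a b [c d]; rewrite /cexp /= expRD cosD sinD.
by apply/eqP; rewrite eq_complex /=; apply/andP; split; apply/eqP; ring.
Qed.

Lemma cexp0 : cexp 0 = 1 :> R[i].
Proof. by rewrite /cexp /= expR0 cos0 sin0 mul1r. Qed.

Lemma cexpN u : cexp (- u) = (cexp u)^-1.
Proof.
have h : cexp (- u) * cexp u = 1 by rewrite -cexpD addNr cexp0.
have u0 : cexp u != 0 by apply: contra_eq_neq h => ->; rewrite mulr0 eq_sym oner_neq0.
by apply: (mulIf u0); rewrite h mulVf.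
Qed.

Lemma cexpMn u n : cexp (n%:R * u) = cexp u ^+ n.
Proof.
elim: n => [|n IH]; first by rewrite mul0r cexp0.
by rewrite -nat1r mulrDl mul1r cexpD IH exprS.
Qed.

Lemma normc_cexp u : normc (cexp u) = expR (complex.Re u).
Proof.
rewrite /cexp normcM normc_real gtr0_norm ?expR_gt0//.
by rewrite /normc /= cos2Dsin2 sqrtr1 mulr1.
Qed.

Lemma normc_cexp_le u : normc (cexp u) <= expR (normc u).
Proof. by rewrite normc_cexp ler_expR (le_trans (ler_norm _)) ?normc_Re. Qed.

Lemma cexp_taylor1 u : normc u <= 2^-1 -> normc (cexp u - 1 - u) <= 8 * normc u ^+ 2.
Proof.
case: u => a b u1.
have a1 : `|a| <= 2^-1 := le_trans (normc_Re (a +i* b)) u1.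
have b1 : `|b| <= 2^-1 := le_trans (normc_Im (a +i* b)) u1.
rewrite sqr_normcE (le_trans (normc_leReIm _))//=.
rewrite !mul0r !subr0 !addr0.
have /andP[e0 e1] := expR_taylor1 _ a1.
have /andP[c0 c1] := cos_taylor0 b.
have s0 := sin_taylor1 b (le_trans b1 _).
have {}s0 : `|sin b - b| <= b ^+ 2 by apply: s0; lra.
have him : `|expR a * sin b - b| <= 2 * a ^+ 2 + 4 * b ^+ 2.
  have -> : expR a * sin b - b = (a + (expR a - 1 - a)) * sin b + (sin b - b) by ring.
  have h1 : `|a + (expR a - 1 - a)| <= 2 * `|a|.
    rewrite (le_trans (ler_normD _ _))// (ger0_norm e0).
    rewrite -(real_normK (num_real a)) in e1.
    by have := normr_ge0 a; set X := _ - a in e1 *; nra.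
  rewrite (le_trans (ler_normD _ _))// normrM.
  have := ler_pM (normr_ge0 _) (normr_ge0 _) h1 (sin_le_norm b).
  rewrite -(real_normK (num_real a)) -(real_normK (num_real b)) in s0 *.
  by have := sqr_ge0 (`|a| - `|b|); nra.
move: s0 a1 b1 (sin_le_norm b); rewrite !ler_norml => /andP[s1 s2] /andP[a1 a2] /andP[b1 b2] /andP[s3 s4].
have E2 : expR a <= 2 by nra.
have E0 := expR_gt0 a.
have hre : `|expR a * cos b - 1 - a| <= 2 * a ^+ 2 + 2 * b ^+ 2.
  rewrite (_ : _ - _ = (expR a - 1 - a) - expR a * (1 - cos b)); last by ring.
  by rewrite ler_norml; nra.
by rewrite mulrDr; move: hre him; nra.
Qed.

(** The approximants are [(1 + z / n) ^ n]. With [u = z / n], factoring [cexp u ^+ n - (1 + u) ^+ n]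
    leaves the second-order error [|u| ^ 2] times [n] bounded terms, hence an error of order
    [1 / n]. *)
Lemma entire_cexp : entire (@cexp R).
Proof.
move=> r e e0; pose s := Num.max r 1.
have s0 : 0 < s by rewrite lt_max ltr01 orbT.
(* The first entry ensures [|u| <= 1/2], as the Taylor estimate requires; the second brings the
   final error below [e]. *)
pose D := Num.max (2 * s) (8 * s ^+ 2 * expR s / e).
pose n := (Num.truncn D).+1; have nD : D < n%:R by apply: truncnS_gt.
have n0 : 0 < n%:R :> R by rewrite ltr0n.
have nC : n%:R != 0 :> R[i] by rewrite pnatr_eq0.
exists ((1 + (n%:R^-1)%:P * 'X) ^+ n) => z zr.
have zs : normc z <= s by rewrite (le_trans zr)// le_max lexx.
rewrite horner_exp !hornerE -[z in cexp z](divfK nC) mulrC [_^-1 * z]mulrC cexpMn.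
set u := z / n%:R.
have us : normc u <= s / n%:R.
  by rewrite normc_div normc_nat ler_pM2r// invr_gt0.
have u2 : normc u <= 2^-1.
  rewrite (le_trans us)// ler_pdivrMr// mulrC ler_pdivlMr// mulrC ltW//.
  by rewrite (le_lt_trans _ nD)// le_max lexx.
rewrite subrXX normcM.
have h1 := cexp_taylor1 u u2; rewrite opprD addrA.
have h2 : normc (\sum_(i < n) cexp u ^+ (n.-1 - i) * (1 + u) ^+ i) <= n%:R * expR s.
  rewrite (le_trans (normc_sum _ _ _ _))//.
  rewrite mulr_natl -[X in _ <= _ *+ X](card_ord n) -sumr_const.
  apply: ler_sum => i _; rewrite normcM !normcX.
  have ha := normc_cexp_le u.
  have hb : normc (1 + u) <= expR (normc u).
    by rewrite (le_trans (le_normcD _ _))// normc1 expR_ge1Dx.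
  have hc : 1 <= expR (normc u) by rewrite -expR0 ler_expR normc_ge0.
  apply: (@le_trans _ _ (expR (normc u) ^+ n)).
    have E : expR (normc u) ^+ n.-1 <= expR (normc u) ^+ n.
      by rewrite ler_weXn2l// leq_pred.
    have i1 : (i <= n.-1)%N by rewrite -ltnS.
    rewrite (le_trans _ E)// -{2}(subnK i1) exprD.
    by rewrite ler_pM ?exprn_ge0 ?normc_ge0// lerXn2r ?nnegrE ?normc_ge0 ?expR_ge0.
  rewrite -expRM_natl ler_expR mulrC -ler_pdivlMr//.
apply: le_trans (ler_pM (normc_ge0 _) (normc_ge0 _) h1 h2) _.
apply: (@le_trans _ _ (8 * (s / n%:R) ^+ 2 * (n%:R * expR s))).
  rewrite ler_wpM2r ?mulr_ge0 ?expR_ge0// ler_wpM2l//.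
  by rewrite lerXn2r ?nnegrE ?normc_ge0// divr_ge0 ?ltW.
rewrite (_ : _ * _ = (8 * s ^+ 2 * expR s) / n%:R); last by field; rewrite gt_eqF.
rewrite ler_pdivrMr// [e * _]mulrC -ler_pdivrMr// ltW// (le_lt_trans _ nD)//.
by rewrite le_max lexx orbT.
Qed.

End ComplexExponential.

(** * The function 1 - e^(2 pi i z) *)

Section SineType.
Context {R : realType}.
Implicit Types (z u : R[i]) (k : int).

Local Notation cexp2pi z := (cexp ((2 * pi)%:C * 'i%C * z)).

(** The supremum of [|e^(i z t)|] over [0 <= t <= 2 pi], which is reached at an endpoint. *)
Definition weight z : R := Num.max 1 (expR (- (2 * pi * complex.Im z))).

Lemma weight_ge1 z : 1 <= weight z.
Proof. by rewrite le_max lexx. Qed.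

Lemma Re_2pii z : complex.Re ((2 * pi)%:C * 'i%C * z) = - (2 * pi * complex.Im z).
Proof. by case: z => a b /=; ring. Qed.

Lemma Im_2pii z : complex.Im ((2 * pi)%:C * 'i%C * z) = 2 * pi * complex.Re z.
Proof. by case: z => a b /=; ring. Qed.

Lemma cexp2pi_int k : cexp2pi k%:~R = 1 :> R[i].
Proof.
have h1 : cexp ((2 * pi)%:C * 'i%C) = 1 :> R[i].
  rewrite /cexp /= !(mul0r, mulr0, mulr1, subr0, addr0) expR0.
  by rewrite mulr_natl cos2pi sin2pi mul1r.
case: k => n; first by rewrite mulrC cexpMn h1 expr1n.
by rewrite NegzE mulrNz mulrN cexpN mulrC cexpMn h1 expr1n invr1.
Qed.

Lemma cexp2piBz z k : cexp2pi (z - k%:~R) = cexp2pi z.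
Proof. by rewrite mulrBr cexpD cexpN cexp2pi_int invr1 mulr1. Qed.

Lemma normc_intr k : normc (k%:~R : R[i]) = `|k|%:~R.
Proof. by rewrite -(rmorph_int (real_complex R)) normc_real -intr_norm. Qed.

Lemma cexp2pi_near1 z : expR (- (2 * pi * complex.Im z)) - 1 <= normc (1 - cexp2pi z)
  /\ 1 - expR (- (2 * pi * complex.Im z)) <= normc (1 - cexp2pi z).
Proof.
rewrite -Re_2pii -normc_cexp; set w := cexp _.
have := ler_normc_sub 1 w; have := ler_normc_sub w 1.
by rewrite normc1 (normcB w).
Qed.

Lemma shift_to_unit_strip z : exists k : int,
  0 <= complex.Re (z - k%:~R) < 1 /\ complex.Im (z - k%:~R) = complex.Im z.
Proof.
exists (Num.floor (complex.Re z)); rewrite -(rmorph_int (real_complex R)).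
rewrite !raddfB /= subr0; split => //; rewrite subr_ge0 floor_le /=.
by rewrite ltrBlDl -intrD1 floorD1_gt.
Qed.

(** Periodicity reduces to [0 <= Re z < 1]. If [|Im z| >= 1/4], the modulus of [w = e^(2 pi i z)] is
    far from 1. Otherwise the distance to 0 and 1 puts [Re z] in [[1/4, 3/4]], so [Re w <= 0] and
    [|1 - w|] is at least both 1 and [|w|]. *)
Lemma one_sub_cexp2pi_ge z : (forall k, 2^-1 <= normc (z - k%:~R)) ->
  (1 - expR (- (pi / 2))) * weight z <= normc (1 - cexp2pi z).
Proof.
wlog /andP[x0 x1] : z / 0 <= complex.Re z < 1 => [H zk|zk].
  have [k [xk yk]] := shift_to_unit_strip z.
  have := H (z - k%:~R) xk; rewrite cexp2piBz /weight yk; apply => j.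
  by rewrite -addrA -opprD -intrD.
set c := 1 - _; have c0 : 0 <= c by rewrite subr_ge0 -expR0 ler_expR oppr_le0 divr_ge0 ?pi_ge0.
have c1 : c <= 1 by rewrite gerBl expR_ge0.
have [y1|y1] := leP 4^-1 `|complex.Im z|.
  have [h1 h2] := cexp2pi_near1 z; have pi0 := pi_gt0 R.
  rewrite /weight maxEle; move: y1; rewrite ler_normr => /orP[] y1.
    have h3 : expR (- (2 * pi * complex.Im z)) <= expR (- (pi / 2)).
      by rewrite ler_expR lerN2; nra.
    by case: ifP => _; rewrite ?mulr1; rewrite /c in c0 *; nra.
  have h3 : expR (2 * pi * complex.Im z) <= expR (- (pi / 2)).
    by rewrite ler_expR; nra.
  have h4 : expR (- (2 * pi * complex.Im z)) * expR (2 * pi * complex.Im z) = 1.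
    by rewrite -expRD addNr expR0.
  have h5 : 1 <= expR (- (2 * pi * complex.Im z)).
    by rewrite -[leLHS]expR0 ler_expR; nra.
  rewrite h5; apply: le_trans h1; rewrite /c.
  set E := expR (- (2 * pi * _)) in h4 h5 *.
  by have := ler_wpM2l (le_trans ler01 h5) h3; nra.
have h0 := zk 0; have h1 := zk 1.
rewrite -(ler_pXn2r (_ : 0 < 2)%N) ?nnegrE ?normc_ge0// in h0.
rewrite -(ler_pXn2r (_ : 0 < 2)%N) ?nnegrE ?normc_ge0// in h1.
rewrite sqr_normcE !raddfB /= subr0 in h0.
rewrite sqr_normcE !raddfB /= subr0 in h1.
have y2 : complex.Im z ^+ 2 <= 4^-1 ^+ 2.
  by rewrite -(real_normK (num_real (complex.Im z))) lerXn2r ?nnegrE ?normr_ge0// ltW.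
have x4 : 4^-1 <= complex.Re z <= 1 - 4^-1 by apply/andP; split; nra.
have cosN : cos (2 * pi * complex.Re z) <= 0.
  have -> : 2 * pi * complex.Re z = (2 * pi * complex.Re z - pi) + pi by ring.
  rewrite cosDpi oppr_le0 cos_ge0_pihalf//.
  by have := pi_gt0 R; move: x4 => /andP[]; nra.
apply: (@le_trans _ _ (weight z)).
  by rewrite ler_piMl// (le_trans ler01)// weight_ge1.
set w := cexp2pi z; have wN : complex.Re w <= 0.
  rewrite /w /cexp Re_2pii Im_2pii /= mul0r subr0.
  by rewrite mulr_ge0_le0 ?expR_ge0.
rewrite -(ler_pXn2r (_ : 0 < 2)%N) ?nnegrE ?normc_ge0//; last first.
  by rewrite (le_trans ler01)// weight_ge1.
have Ew : expR (- (2 * pi * complex.Im z)) ^+ 2 = complex.Re w ^+ 2 + complex.Im w ^+ 2.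
  by rewrite -Re_2pii -normc_cexp sqr_normcE.
clearbody w; rewrite sqr_normcE !raddfB /= sub0r sqrrN /weight maxEle.
by case: ifP => _; rewrite ?Ew ?expr1n; nra.
Qed.

Lemma one_sub_cexp2pi_eq0 z : 1 - cexp2pi z = 0 -> exists k, z = k%:~R.
Proof.
wlog /andP[x0 x1] : z / 0 <= complex.Re z < 1 => [H zk|].
  have [k [xk _]] := shift_to_unit_strip z.
  have [|j Ej] := H (z - k%:~R) xk; first by rewrite cexp2piBz.
  by exists (k + j); rewrite intrD -Ej addrC subrK.
move=> /eqP; rewrite subr_eq0 => /eqP/esym w1.
have y0 : complex.Im z = 0.
  have := congr1 (@normc R) w1; rewrite normc1 normc_cexp Re_2pii -[X in _ = X]expR0.
  by move=> /expR_inj/eqP; rewrite oppr_eq0 !mulf_eq0 pnatr_eq0 (gt_eqF (pi_gt0 R)) => /eqP.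
have cos1 : cos (2 * pi * complex.Re z) = 1.
  have := congr1 (@complex.Re R) w1.
  by rewrite /cexp Re_2pii Im_2pii /= y0 mulr0 oppr0 expR0 mul0r subr0 mul1r.
suff xz : complex.Re z = 0.
  by exists 0; move: xz y0; case: (z) => a b /= -> ->.
have pi0 := pi_gt0 R.
have [xh|xh] := leP (complex.Re z) 2^-1.
  have : 2 * pi * complex.Re z = 0.
    apply: cos_inj; rewrite ?cos0// in_itv /= ?lexx ?pi_ge0//.
    by apply/andP; split; nra.
  by move=> /eqP; rewrite !mulf_eq0 pnatr_eq0 (gt_eqF pi0) => /eqP.
(* [cos] is injective on [[0, pi]] only, so the angle is reflected into that interval; the outcome
   [Re z = 1] is excluded. *)
have : pi *+ 2 - 2 * pi * complex.Re z = 0.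
  apply: cos_inj; rewrite ?cos0 ?in_itv /= ?lexx ?pi_ge0//.
    by rewrite mulr2n; apply/andP; split; nra.
  by rewrite -cosN opprB -cosD2pi subrK.
by rewrite mulr2n; nra.
Qed.

End SineType.

(** * The zeros are the integers, all of them simple *)

Section IntegerZeros.
Context {R : realType}.
Implicit Types (z u : R[i]) (k : int).

Local Notation cexp2pi z := (cexp ((2 * pi)%:C * 'i%C * z)).

(** A multiple zero would make the function quadratically small at [k + t] for small real [t],
    whereas the linear term of the exponential has modulus [2 pi t]. *)
Lemma one_sub_cexp2pi_simple k (G : R[i] -> R[i]) : entire G ->
  ~ (forall z, 1 - cexp2pi z = (z - k%:~R) ^+ 2 * G z).
Proof.
move=> hG H; pose z0 : R[i] := k%:~R.
have [C C0 HC] := entire_bounded_disk G (normc z0 + 1) hG.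
have pi2 := pi_ge2 R.
(* [B] gathers the quadratic terms: [C] from [G], and [32 * pi ^+ 2] from the Taylor remainder at
   [|u| = 2 pi t]. Then [2 pi t <= B * t ^+ 2 <= t] is absurd; the bound [(4 * pi)^-1] on [t] keeps
   [|u| <= 1/2]. *)
pose B := C + 32 * pi ^+ 2; have B0 : 0 < B by rewrite /B; nra.
pose t : R := Num.min (4 * pi)^-1 B^-1.
have t0 : 0 < t by rewrite lt_min !invr_gt0 B0 andbT; lra.
have /andP[t1 t2] : (t <= (4 * pi)^-1) && (t <= B^-1) by rewrite -le_min.
have {}t1 : t * (4 * pi) <= 1 by rewrite -ler_pdivlMr ?mul1r//; lra.
have {}t2 : t * B <= 1 by rewrite -ler_pdivlMr ?mul1r.
pose u : R[i] := (2 * pi)%:C * 'i%C * t%:C.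
have uE : normc u = 2 * pi * t.
  by rewrite !normcM !normc_real normc_i mulr1 !gtr0_norm//; lra.
have h1 := cexp_taylor1 u; rewrite uE in h1.
have {}h1 : normc (cexp u - 1 - u) <= 8 * (2 * pi * t) ^+ 2 by apply: h1; lra.
have h2 := H (z0 + t%:C); rewrite -(cexp2piBz _ k) -/z0 addrAC subrr add0r in h2.
have h3 : normc (1 - cexp u) <= t ^+ 2 * C.
  rewrite h2 normcM normcX normc_real gtr0_norm// ler_wpM2l ?exprn_ge0 ?(ltW t0)//.
  apply: HC; rewrite (le_trans (le_normcD _ _))// lerD2l normc_real gtr0_norm//.
  nra.
have h4 : normc u <= normc (cexp u - 1 - u) + normc (1 - cexp u).
  rewrite -[normc u]normcN; apply: le_trans (le_normcD _ _).
  by rewrite (_ : _ + _ = - u) //; ring.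
rewrite uE in h4; rewrite /B in t2; nra.
Qed.

(** Simplicity makes [s] duplicate-free, so it is enough to compare its elements with the integers
    from [- n] to [n], which are those of modulus below [n + 1/2]. *)
Lemma zeros_one_sub_cexp2pi n s g :
  zeros_factored (n%:R + 2^-1 : R) (fun z => 1 - cexp2pi z) s g ->
  (forall z, normc z <= n%:R + 2^-1 -> g z != 0) -> size s = (2 * n + 1)%N.
Proof.
move=> [hg fg sr] g0.
have s0 a : a \in s -> 1 - cexp2pi a = 0.
  move=> sa; rewrite fg; have : root (\prod_(a <- s) ('X - a%:P)) a by rewrite root_prod_XsubC.
  by rewrite /root => /eqP ->; rewrite mul0r.
pose t : seq R[i] := [seq (i%:Z - n%:Z)%:~R | i <- iota 0 (2 * n + 1)].
have ut : uniq t.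
  rewrite map_inj_uniq ?iota_uniq// => i j /(mulrIz (oner_neq0 _)) ij.
  by lia.
have us : uniq s.
  apply: count_mem_uniq => a; case: (boolP (a \in s)) => sa; last exact/count_memPn.
  apply/eqP; rewrite eqn_leq -has_count has_pred1 sa andbT leqNgt; apply/negP => c2.
  have [k ak] := one_sub_cexp2pi_eq0 _ (s0 _ sa).
  have [m cE] : exists m, count_mem a s = m.+2.
    by exists (count_mem a s).-2; lia.
  have [h hh] := vanishing_factor a (And3 hg fg sr); rewrite cE => fh.
  apply: (@one_sub_cexp2pi_simple k (fun z => (('X - a%:P) ^+ m).[z] * h z)).
    exact: entireMpoly.
  by move=> z; rewrite fh -ak horner_exp hornerXsubC mulrA -exprD.
suff st : s =i t by rewrite (perm_size (uniq_perm us ut st)) size_map size_iota.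
move=> a; apply/idP/mapP => [sa| [j]].
  have [k ak] := one_sub_cexp2pi_eq0 _ (s0 _ sa).
  have := sr _ sa; rewrite ak normc_intr => kn.
  have {}kn : `|k| < n%:Z + 1.
    by rewrite -(ltr_int R) intrD; apply: (lt_trans kn); rewrite ltrD2l; lra.
  exists (absz (k + n%:Z)%R); first by rewrite mem_iota; lia.
  by congr _%:~R; lia.
rewrite mem_iota => /andP[_ j2] ai.
have an : normc a <= n%:R + 2^-1.
  have : `|j%:Z - n%:Z| <= n%:Z by lia.
  by rewrite ai normc_intr -(ler_int R) => /le_trans; apply; rewrite lerDl; lra.
have := fg a; rewrite {1}ai cexp2pi_int subrr => /esym/eqP.
by rewrite mulf_eq0 (negbTE (g0 _ an)) orbF -/(root _ a) root_prod_XsubC.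
Qed.

End IntegerZeros.

(** * Zero count for small perturbations *)

Section ZerosOfPerturbation.
Context {R : realType}.
Implicit Types (z u : R[i]) (k : int).

Local Notation cexp2pi z := (cexp ((2 * pi)%:C * 'i%C * z)).

(** For [|k| <= n] the modulus of [z] keeps it away from [k], for [|k| > n] its real part does. This
    covers the circle as well as the part of the rectangle outside the disc. *)
Lemma away_from_integers n z : n%:R + 2^-1 <= normc z ->
  `|complex.Re z| <= n%:R + 2^-1 -> forall k, 2^-1 <= normc (z - k%:~R).
Proof.
move=> nz xn k; have [kn|kn] := leP `|k| n%:Z.
  have {}kn : (`|k|%:~R : R) <= n%:R by rewrite -(ler_int R) in kn.
  by have := ler_normc_sub z k%:~R; rewrite normc_intr; lra.
have {}kn : n%:R + 1 <= `|k%:~R : R|.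
  by rewrite -intr_norm -(intrD1 n%:Z) ler_int; lia.
have := normc_Re (z - k%:~R); rewrite -(rmorph_int (real_complex R)) raddfB /=.
have := ler_distD (complex.Re z) 0 (k%:~R : R).
rewrite !sub0r !normrN; lra.
Qed.

Lemma entire_one_sub_cexp2pi : entire (fun z => 1 - cexp2pi z).
Proof.
apply: (entireD (fun=> 1) (fun z => - cexp2pi z)); first exact: entire_cst.
have -> : (fun z => - cexp2pi z) = (fun z => -1 * cexp2pi z).
  by apply/funext => z; rewrite mulN1r.
exact/entireZ/entire_scale/entire_cexp.
Qed.

Lemma has_zeros_perturbed_one_sub_cexp2pi (f : R[i] -> R[i]) : entire f ->
  (forall e : R, 0 < e -> exists B : R, forall z, B <= normc z ->
     normc (f z - (1 - cexp2pi z)) <= e * weight z) ->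
  exists (N : nat) (b0 : R), 0 < b0 /\
    forall (n : nat) (b : R), (N <= n)%N -> b0 <= b ->
      has_zeros f (rectangle n b) (2 * n + 1)%N.
Proof.
move=> hf decay; pose c : R := 1 - expR (- (pi / 2)); pose f0 z := 1 - cexp2pi z.
have c0 : 0 < c by rewrite subr_gt0 -[ltRHS]expR0 ltr_expR oppr_lt0 divr_gt0 ?pi_gt0.
have c2 : 0 < c / 2 by lra.
have [B HB] := decay _ c2.
(* The perturbation is at most [c / 2 * weight z] and [f0] at least [c * weight z]; since
   [weight z >= 1], a uniform margin [c / 2] remains. *)
have far z : B <= normc z -> (forall k, 2^-1 <= normc (z - k%:~R)) ->
    normc (f z - f0 z) + c / 2 <= normc (f0 z).
  move=> /HB h1 /one_sub_cexp2pi_ge; rewrite -/c => h2.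
  by have := weight_ge1 z; rewrite -/(f0 z) in h1 h2; nra.
have far0 z : B <= normc z -> (forall k, 2^-1 <= normc (z - k%:~R)) ->
    c / 2 <= normc (f z).
  move=> Bz zk; have := far z Bz zk; rewrite normcB.
  by have := ler_normc_dist (f0 z) (f z); lra.
have hf0 : entire f0 := entire_one_sub_cexp2pi.
(* [N] makes the radius [n + 1/2] exceed [B]. The height exceeds [B] as well, and being at least 1
   it keeps points above or below the rectangle away from the integers. *)
exists (Num.truncn B).+1, (Num.max B 1); split; first by rewrite lt_max ltr01 orbT.
move=> n b nB; rewrite ge_max => /andP[bB b1].
pose r : R := n%:R + 2^-1.
have r0 : 0 < r by rewrite ltr_wpDl.
have rB : B <= r.
  have : (Num.truncn B).+1%:R <= n%:R :> R by rewrite ler_nat.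
  by have := truncnS_gt B; rewrite /r; lra.
have circ z : normc z = r -> B <= normc z /\ forall k, 2^-1 <= normc (z - k%:~R).
  move=> zr; split; first by rewrite zr.
  by apply: (@away_from_integers n); rewrite ?zr// -/r -zr normc_Re.
have fd z : normc z = r -> c / 2 <= normc (f z) by move=> /circ[]; exact: far0.
have f0d z : normc z = r -> c / 2 <= normc (f0 z).
  by move=> /circ[h1 h2]; have := far z h1 h2; have := normc_ge0 (f z - f0 z); lra.
have [s [g [sg g0]]] := entire_factorization r0 c2 hf fd.
have [s' [g' [sg' g0']]] := entire_factorization r0 c2 hf0 f0d.
have Es : size s = (2 * n + 1)%N.
  rewrite -(zeros_one_sub_cexp2pi _ _ _ sg' g0').
  by apply: (entire_rouche r0 c2 sg g0 sg' g0') => z /circ[]; exact: far.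
have [hg fg sr] := sg.
exists s; split => // [z zs|z [/andP[x1 x2] _]].
  have zr := sr _ zs; split.
    by rewrite -ler_norml -/r (le_trans (normc_Re _)) ?ltW.
  rewrite -ler_norml leNgt; apply/negP => yb.
  have fz : f z = 0.
    by rewrite fg (_ : _.[z] = 0) ?mul0r//; apply/eqP; rewrite -/(root _ z) root_prod_XsubC.
  have := far0 z; rewrite fz normc0 => H.
  suff : c / 2 <= 0 by lra.
  apply: H.
    by rewrite (le_trans bB)// (le_trans (ltW yb)) ?normc_Im.
  move=> k; apply: (le_trans _ (normc_Im _)).
  by rewrite -(rmorph_int (real_complex R)) raddfB /= subr0; lra.
(* Inside the disc [g] has no zero by construction; in the rest of the rectangle [f] itself does not
   vanish, hence neither does [g]. *)
apply: (vanishing_order_factor sg); have [/g0//|/ltW rz] := leP (normc z) r.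
have := far0 z (le_trans rB rz) (away_from_integers _ _ rz _).
rewrite ler_norml x1 x2 => /(_ isT) fz.
by apply: contraTneq fz => gz; rewrite fg gz mulr0 normc0 -ltNge.
Qed.

End ZerosOfPerturbation.

(** * The Riemann-Lebesgue lemma *)

Section RiemannLebesgue.
#[local] Set Implicit Arguments.
#[local] Unset Strict Implicit.
Context {R : realType}.
Notation mu := (@lebesgue_measure R).
Notation D := (`]0, 2 * pi[%classic : set R).
Implicit Types (x y t phi : R) (k : R -> R).

(* The real part of e^(i (z t + phi)) for z = x + i y; the phases 0 and - pi / 2
   give the real and imaginary parts of e^(i z t). *)
Definition osc x y phi t : R := expR (- (y * t)) * cos (x * t + phi).

Definition osc_bound y : R := Num.max 1 (expR (- (2 * pi * y))).

Lemma osc_bound_ge1 y : 1 <= osc_bound y.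
Proof. by rewrite le_max lexx. Qed.

Lemma expR_le_osc_bound y t : 0 <= t <= 2 * pi -> expR (- (y * t)) <= osc_bound y.
Proof.
move=> /andP[t0 t1]; rewrite /osc_bound le_max; have [y0|/ltW y0] := leP 0 y.
  by rewrite -[X in _ <= X]expR0 ler_expR oppr_le0 mulr_ge0.
by apply/orP; right; rewrite ler_expR lerN2; nra.
Qed.

Lemma osc_le x y phi t : D t -> `|osc x y phi t| <= osc_bound y.
Proof.
rewrite /= in_itv /= => /andP[/ltW t0 /ltW t1].
rewrite normrM ger0_norm ?expR_ge0// (le_trans _ (expR_le_osc_bound y (_ : 0 <= t <= 2 * pi)))//; last first.
  by rewrite t0 t1.
by rewrite ler_piMr ?expR_ge0// cos_max.
Qed.

(** The real part of [e^(i (z t + phi)) / (i z)] for [z = x + i y]. *)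
Definition osc_primitive x y phi t : R :=
  expR (- (y * t)) * (x * sin (x * t + phi) - y * cos (x * t + phi))
  / (x ^+ 2 + y ^+ 2).

Lemma is_derive_osc_primitive x y phi t : x ^+ 2 + y ^+ 2 != 0 ->
  is_derive t 1 (osc_primitive x y phi) (osc x y phi t).
Proof.
move=> xy0.
have h1 : is_derive t 1 (fun t => expR (- (y * t))) (expR (- (y * t)) * - y).
  have h : is_derive t 1 (fun t => - (y * t)) (- y) by apply: is_derive_eq; rewrite scaler1.
  exact: (@is_derive1_comp _ expR (fun t => - (y * t))).
have h2 : is_derive t 1 (fun t => x * t + phi) x by apply: is_derive_eq; rewrite scaler1 addr0.
have h3 : is_derive t 1 (fun t => sin (x * t + phi)) (cos (x * t + phi) * x).
  exact: (@is_derive1_comp _ sin (fun t => x * t + phi)).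
have h4 : is_derive t 1 (fun t => cos (x * t + phi)) (- sin (x * t + phi) * x).
  exact: (@is_derive1_comp _ cos (fun t => x * t + phi)).
rewrite /osc_primitive /osc; apply: is_derive_eq.
rewrite /GRing.scale /=; field.
by rewrite xy0.
Qed.

Lemma osc_continuous x y phi : continuous (osc x y phi).
Proof.
move=> t; apply: cvgM.
  apply: continuous_comp; last exact: continuous_expR.
  by apply: cvgN; apply: cvgM; [exact: cvg_cst|exact: cvg_id].
apply: continuous_comp; last exact: continuous_cos.
by apply: cvgD; [apply: cvgM; [exact: cvg_cst|exact: cvg_id]|exact: cvg_cst].
Qed.

Lemma integral_osc_cc x y phi a b : x ^+ 2 + y ^+ 2 != 0 -> a < b ->
  \int[mu]_(t in `[a, b]) osc x y phi t
  = osc_primitive x y phi b - osc_primitive x y phi a.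
Proof.
move=> xy0 ab; have hd t := is_derive_osc_primitive phi t xy0.
have hc : continuous (osc_primitive x y phi).
  by move=> t; apply/differentiable_continuous/derivable1_diffP; case: (hd t).
rewrite /Rintegral (@continuous_FTC2 _ _ (osc_primitive x y phi)) //.
- by apply: continuous_subspaceT; exact: osc_continuous.
- split => [t _||].
  + by case: (hd t).
  + by apply: cvg_at_right_filter; exact: hc.
  + by apply: cvg_at_left_filter; exact: hc.
- by move=> t _; rewrite derive1E; case: (hd t).
Qed.

(** The trigonometric factor is at most [|x| + |y|], of order [|z|], against the denominator
    [|z| ^ 2]: this is the gain of [1 / B]. *)
Lemma osc_primitive_le x y phi t (B : R) : 0 < B -> B ^+ 2 <= x ^+ 2 + y ^+ 2 ->
  0 <= t <= 2 * pi -> `|osc_primitive x y phi t| <= 2 * osc_bound y / B.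
Proof.
move=> B0 Bxy t01; pose q := x ^+ 2 + y ^+ 2.
have q0 : 0 < q by rewrite /q (lt_le_trans _ Bxy)// exprn_gt0.
rewrite /osc_primitive -/q normrM normfV (gtr0_norm q0) ler_pdivrMr//.
rewrite normrM ger0_norm ?expR_ge0//.
have E := expR_le_osc_bound y t01.
have h : `|x * sin (x * t + phi) - y * cos (x * t + phi)| <= `|x| + `|y|.
  rewrite (le_trans (ler_normB _ _))// !normrM lerD// ler_piMr// ?sin_max ?cos_max//.
have h2 : `|x| + `|y| <= 2 / B * q.
  have hx : B * `|x| <= q.
    have := sqr_ge0 (B - `|x|); have := sqr_ge0 y; have := real_normK (num_real x).
    by rewrite /q; nra.
  have hy : B * `|y| <= q.
    have := sqr_ge0 (B - `|y|); have := sqr_ge0 x; have := real_normK (num_real y).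
    by rewrite /q; nra.
  by rewrite mulrAC ler_pdivlMr//; nra.
rewrite (le_trans (ler_pM (expR_ge0 _) (normr_ge0 _) E h))//.
rewrite (_ : 2 * _ / B * q = osc_bound y * (2 / B * q)); last by ring.
by rewrite ler_wpM2l// (le_trans ler01)// osc_bound_ge1.
Qed.

End RiemannLebesgue.

(** * From indicators of rays to integrable functions *)

Section RiemannLebesgueL1.
#[local] Set Implicit Arguments.
#[local] Unset Strict Implicit.
Context {R : realType}.
Notation mu := (@lebesgue_measure R).
Notation D := (`]0, 2 * pi[%classic : set R).
Implicit Types (x y t phi : R) (k : R -> R).
Notation measurableR := (@measurable _ (measurableTypeR R)).
Let mD : measurableR D := measurable_itv _.

Definition integ k : Prop := mu.-integrable D (EFin \o k).

Lemma integ_bounded_mul (h : R -> R) k (M : R) : measurable_fun D h ->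
  (forall t, D t -> `|h t| <= M) -> integ k -> integ (fun t => h t * k t).
Proof.
move=> mh hM ik; apply: (@integrableMr _ _ _ mu D mD h (EFin \o k)) => //.
by exists M; split; [exact: num_real|move=> N MN t Dt; exact: le_trans (hM _ Dt) (ltW MN)].
Qed.

Lemma integ_osc x y phi k : integ k -> integ (fun t => osc x y phi t * k t).
Proof.
apply: (@integ_bounded_mul _ _ (osc_bound y)); last by move=> t; exact: osc_le.
by apply: measurable_funTS; apply: continuous_measurable_fun; exact: osc_continuous.
Qed.

Lemma integB k1 k2 : integ k1 -> integ k2 -> integ (fun t => k1 t - k2 t).
Proof. by move=> i1 i2; exact: (integrableB mD i1 i2). Qed.

Lemma integD k1 k2 : integ k1 -> integ k2 -> integ (fun t => k1 t + k2 t).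
Proof. by move=> i1 i2; exact: (integrableD mD i1 i2). Qed.

Lemma integZ (c : R) k : integ k -> integ (fun t => c * k t).
Proof. by move=> i1; exact: (integrableZl mD c i1). Qed.

Lemma integ_norm k : integ k -> integ (fun t => `|k t|).
Proof. exact: integrable_norm. Qed.

(** Measuring the decay relative to [osc_bound y], which dominates [osc] on the interval, makes the
    property stable under L1 limits, uniformly in the complex frequency. *)
Definition decays k : Prop := forall e : R, 0 < e -> exists2 B : R, 0 < B &
  forall x y phi, B ^+ 2 <= x ^+ 2 + y ^+ 2 ->
    `|\int[mu]_(t in D) (osc x y phi t * k t)| <= e * osc_bound y.

Lemma decaysD k1 k2 : integ k1 -> integ k2 ->
  decays k1 -> decays k2 -> decays (fun t => k1 t + k2 t).
Proof.
move=> i1 i2 d1 d2 e e0; have e2 : 0 < e / 2 by lra.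
have [B1 B10 H1] := d1 _ e2; have [B2 B20 H2] := d2 _ e2.
exists (Num.max B1 B2) => [|x y phi]; first by rewrite lt_max B10.
move=> Bxy; under eq_Rintegral do rewrite mulrDr.
rewrite RintegralD//; [|exact: integ_osc..].
have -> : e * osc_bound y = e / 2 * osc_bound y + e / 2 * osc_bound y by field.
rewrite (le_trans (ler_normD _ _))// lerD//.
- apply: H1; apply: le_trans Bxy.
  by rewrite lerXn2r ?nnegrE ?le_max ?lexx ?(ltW B10).
- apply: H2; apply: le_trans Bxy.
  by rewrite lerXn2r ?nnegrE ?le_max ?lexx ?(ltW B10) ?(ltW B20) ?orbT.
Qed.

Lemma decaysZ (c : R) k : integ k -> decays k -> decays (fun t => c * k t).
Proof.
move=> ik dk e e0; have c1 : 0 < `|c| + 1 by rewrite ltr_wpDl.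
have [|B B0 H] := dk (e / (`|c| + 1)); first exact: divr_gt0.
exists B => // x y phi /(H x y phi) h; under eq_Rintegral do rewrite mulrCA.
rewrite RintegralZl//; last exact: integ_osc.
have := osc_bound_ge1 y => o1.
rewrite normrM; apply: le_trans (ler_wpM2l (normr_ge0 _) h) _.
rewrite mulrA ler_wpM2r//; first by lra.
by rewrite mulrCA ler_piMr ?(ltW e0)// ler_pdivrMr// mul1r; lra.
Qed.

Lemma decays_lim k : integ k -> (forall e : R, 0 < e -> exists k',
   [/\ integ k', decays k' & \int[mu]_(t in D) `|k t - k' t| <= e]) -> decays k.
Proof.
move=> ik H e e0; have e2 : 0 < e / 2 by lra.
have [k' [ik' dk' kk']] := H _ e2; have [B B0 HB] := dk' _ e2.
exists B => // x y phi /(HB x y phi) h; have o1 := osc_bound_ge1 y.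
have -> : \int[mu]_(t in D) (osc x y phi t * k t) =
   \int[mu]_(t in D) (osc x y phi t * k' t) +
   \int[mu]_(t in D) (osc x y phi t * (k t - k' t)).
  rewrite -RintegralD//; [|exact: integ_osc|exact/integ_osc/integB].
  by apply: eq_Rintegral => t _; ring.
have -> : e * osc_bound y = e / 2 * osc_bound y + e / 2 * osc_bound y by field.
rewrite (le_trans (ler_normD _ _))// lerD//.
have id := integ_norm (integB ik ik').
rewrite (le_trans (le_normr_Rintegral _ _))//; first exact/integ_osc/integB.
rewrite [e / 2 * _]mulrC; apply: (@le_trans _ _ (osc_bound y * \int[mu]_(t in D) `|k t - k' t|)).
  rewrite -RintegralZl//; apply: le_Rintegral => //.
  - exact/integ_norm/integ_osc/integB.
  - exact: integZ.
  - by move=> t Dt; rewrite normrM ler_wpM2r// osc_le.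
by rewrite ler_wpM2l//; lra.
Qed.

Lemma integ_indic (A : set R) : measurableR A -> integ \1_A.
Proof.
move=> mA; apply: measurable_bounded_integrable => //.
- by rewrite /= lebesgue_measure_itv /=; case: ifP => _; rewrite ?ltry// -EFinB ltry.
- exists 1; split; [exact: num_real|move=> N N1 t _].
  by rewrite /= indicE ger0_norm// (le_trans _ (ltW N1))// lern1 leq_b1.
Qed.

Lemma decays_indic_ray (c : R) : decays \1_(`]c, +oo[%classic).
Proof.
(* With [B = 4 / e] the primitive contributes at most [e / 2 * osc_bound y] at each endpoint. *)
move=> e e0; have e4 : 0 < 4 / e by rewrite divr_gt0.
exists (4 / e) => // x y phi Bxy; have o1 := osc_bound_ge1 y.
have xy0 : x ^+ 2 + y ^+ 2 != 0.
  by rewrite gt_eqF// (lt_le_trans _ Bxy)// exprn_gt0.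
pose a := Num.max 0 c.
have -> : \int[mu]_(t in D) (osc x y phi t * \1_(`]c, +oo[%classic) t)
    = \int[mu]_(t in `]a, 2 * pi[) osc x y phi t.
  transitivity (\int[mu]_(t in D `&` `]c, +oo[%classic) osc x y phi t).
    rewrite Rintegral_mkcondr; apply: eq_Rintegral => t _.
    by rewrite patchE indicE; case: ifP => _; rewrite ?mulr1 ?mulr0.
  congr Rintegral; apply/seteqP; split => t /=; rewrite !in_itv /= andbT gt_max.
    by move=> [/andP[-> ->] ->].
  by move=> /andP[/andP[-> ->] ->].
have a0 : 0 <= a by rewrite le_max lexx.
have [ap|pa] := ltP a (2 * pi); last first.
  rewrite set_itv_ge ?bnd_simp -?leNgt// Rintegral_set0 normr0 mulr_ge0 ?(ltW e0)//.
  exact: le_trans o1.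
have ic : mu.-integrable `[a, 2 * pi] (EFin \o osc x y phi).
  apply: continuous_compact_integrable; first exact: segment_compact.
  exact/continuous_subspaceT/osc_continuous.
rewrite Rintegral_itv_bndo_bndc; last first.
  by apply: integrableS ic => //; exact: subset_itvW.
rewrite Rintegral_itv_obnd_cbnd; last first.
  by apply: integrableS ic => //; exact: subset_itv_oc_cc.
rewrite integral_osc_cc// (le_trans (ler_normB _ _))//.
have h t : 0 <= t <= 2 * pi -> `|osc_primitive x y phi t| <= e / 2 * osc_bound y.
  move=> ht; rewrite (le_trans (osc_primitive_le phi e4 Bxy ht))//.
  rewrite le_eqVlt; apply/orP; left; apply/eqP; field; rewrite gt_eqF//.
have -> : e * osc_bound y = e / 2 * osc_bound y + e / 2 * osc_bound y by field.
by rewrite lerD// h// ?a0 ?(ltW ap)// lexx andbT (le_trans a0 (ltW ap)).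
Qed.

(** Dynkin's pi-lambda theorem: the rays []c, +oo[] are closed under intersection and generate the
    Borel sets, and the sets whose indicator decays form a lambda-system. *)
Lemma decays_indic (A : set R) : measurableR A -> decays \1_A.
Proof.
have hT : decays \1_[set: R].
  move=> e e0; have [B B0 HB] := @decays_indic_ray 0 e e0; exists B => // x y phi /(HB x y phi).
  congr (`|_| <= _); apply: eq_Rintegral => t; rewrite inE /= in_itv /= => /andP[t0 _].
  by rewrite !indicE !mem_set//= in_itv /= t0.
pose H := [set A : set R | measurableR A /\ decays \1_A].
suff HH : measurableR `<=` H by move=> mA; case: (HH A mA).
have -> : measurableR = <<s @RGenOInfty.G R >> by exact: RGenOInfty.measurableE.
apply: (@lambda_system_subset _ _ _ setT) => //.
- move=> X Y [x ->] [y ->]; exists (Num.max x y).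
  by apply/seteqP; split => t; rewrite /= !in_itv /= !andbT gt_max => /andP.
- split => //.
  + move=> X Y YX [mX dX] [mY dY]; split; first exact: measurableD.
    have -> : \1_(X `\` Y) = (fun t => \1_X t + -1 * \1_Y t) :> (R -> R).
      apply/funext => t; rewrite !indicE in_setD mulN1r.
      have [tY|tY] := boolP (t \in Y); last by rewrite subr0 andbT.
      by rewrite (mem_set (YX _ (set_mem tY))) subrr.
    apply: decaysD => //; [exact: integ_indic|exact/integZ/integ_indic|].
    by apply: decaysZ => //; exact: integ_indic.
  + move=> F ndF HF; have mF i : measurableR (F i) by case: (HF i).
    have mU : measurableR (\bigcup_i F i) by exact: bigcupT_measurable.
    split => //; apply: decays_lim; first exact: integ_indic.
    move=> e e0.
    (* The interval has finite measure, so continuity from below turns an increasing union into L1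
       convergence of the indicators. *)
    have : (fun n => Rintegral mu D \1_(F n)) @ \oo --> Rintegral mu D \1_(\bigcup_i F i).
      have Iind (A' : set R) : measurableR A' -> Rintegral mu D \1_A' = fine (mu (A' `&` D)).
        by move=> mA'; rewrite /Rintegral integral_indic.
      under eq_fun do rewrite Iind//.
      rewrite Iind// setI_bigcupl; apply: fine_cvg; rewrite fineK.
        apply: nondecreasing_cvg_mu => [i||].
        - exact: measurableI.
        - by apply: bigcupT_measurable => i; exact: measurableI.
        - by move=> m n mn; apply/subsetPset; apply: setSI; exact/subsetPset/ndF.
      rewrite ge0_fin_numE//.
      apply: (@le_lt_trans _ _ (mu D)).
        by rewrite -setI_bigcupl le_measure ?inE//; apply: measurableI.
      by rewrite /= lebesgue_measure_itv /=; case: ifP => _; rewrite ?ltry// -EFinB ltry.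
    move=> /cvgrPdist_le/(_ _ e0)[n _ /(_ n (leqnn _)) H'].
    exists \1_(F n); split; [exact: integ_indic|by case: (HF n)|].
    have FU t : 0 <= \1_(\bigcup_i F i) t - \1_(F n) t :> R.
      rewrite subr_ge0 !indicE ler_nat; have [tF|] := boolP (t \in F n) => //.
      by rewrite mem_set//; exists n => //; exact: set_mem.
    under eq_Rintegral do rewrite ger0_norm//.
    rewrite RintegralB//; [|exact: integ_indic..].
    exact: le_trans (ler_norm _) H'.
- by move=> _ [x ->]; split => //; exact: decays_indic_ray.
Qed.

(** Simple functions approximate [k] in L1, and each is a finite combination of indicators. *)
Lemma riemann_lebesgue k : integ k -> decays k.
Proof.
move=> ik; apply: decays_lim => // e e0.
have [g [ig _ gk]] := approximation_sfun_integrable mD ik.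
have /fine_cvgP[_ /cvgrPdist_le/(_ _ e0)[n _ /(_ n (leqnn _)) H]] := gk.
pose gn : R -> R := g n; exists gn; split; first exact: ig.
- have [N [c [A [mA gE]]]] : exists N (c : nat -> R) (A : nat -> set R),
      (forall i, measurableR (A i)) /\
      gn = (fun t => \sum_(i < N) c i * \1_(A i) t).
    pose s := finmap.enum_fset (fset_set (range (g n))).
    exists (size s), (nth 0 s),
      (fun i => g n @^-1` [set nth 0 s i]).
    by split => [i|]; [exact: measurable_sfunP|apply/funext => t; exact: fimfunEord].
  suff : integ (fun t => \sum_(i < N) c i * \1_(A i) t) /\
      decays (fun t => \sum_(i < N) c i * \1_(A i) t) by rewrite gE => -[].
  elim: {gE} N => [|m [im dm]].
    have -> : (fun t => \sum_(i < 0) c i * \1_(A i) t) = (fun t => 0 * \1_[set: R] t).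
      by apply/funext => t; rewrite big_ord0 mul0r.
    have iT := integ_indic (@measurableT _ (measurableTypeR R)).
    by split; [exact: integZ|apply/decaysZ/decays_indic].
  have i1 := integZ (c m) (integ_indic (mA m)).
  have d1 := decaysZ (c m) (integ_indic (mA m)) (decays_indic (mA m)).
  by split; under eq_fun do rewrite big_ord_recr /=; [exact: integD|exact: decaysD].
- by move: H; rewrite /= sub0r normrN; apply: le_trans; exact: ler_norm.
Qed.

End RiemannLebesgueL1.

(** * Complex Fourier integrals *)

Section ComplexIntegral.
#[local] Set Implicit Arguments.
#[local] Unset Strict Implicit.
Context {R : realType}.
Notation mu := (@lebesgue_measure R).
Notation D := (`]0, 2 * pi[%classic : set R).
Notation measurableR := (@measurable _ (measurableTypeR R)).
Let mD : measurableR D := measurable_itv _.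
Implicit Types (f g k : R -> R[i]).

Definition cinteg f : Prop :=
  integ (fun t => complex.Re (f t)) /\ integ (fun t => complex.Im (f t)).

Lemma cintegD f g : cinteg f -> cinteg g -> cinteg (fun t => f t + g t).
Proof.
move=> [f1 f2] [g1 g2]; split; under eq_fun do rewrite raddfD /=; exact: integD.
Qed.

Lemma cintegZ (c : R[i]) f : cinteg f -> cinteg (fun t => c * f t).
Proof.
move=> [f1 f2]; split.
- by under eq_fun do rewrite ReM; apply: integB; exact: integZ.
- by under eq_fun do rewrite ImM; apply: integD; exact: integZ.
Qed.

Lemma cintegral_add f g : cinteg f -> cinteg g ->
  cintegral D (fun t => f t + g t) = cintegral D f + cintegral D g.
Proof.
move=> [f1 f2] [g1 g2]; rewrite /cintegral.
under eq_Rintegral do rewrite raddfD.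
under [X in _ +i* X]eq_Rintegral do rewrite raddfD.
by rewrite !RintegralD.
Qed.

Lemma cintegral_scale (c : R[i]) f : cinteg f ->
  cintegral D (fun t => c * f t) = c * cintegral D f.
Proof.
move=> [f1 f2]; rewrite /cintegral.
under eq_Rintegral do rewrite ReM.
under [X in _ +i* X]eq_Rintegral do rewrite ImM.
rewrite RintegralB ?RintegralD//; [|exact: integZ..].
rewrite !RintegralZl//.
by apply/eqP; rewrite eq_complex ReM ImM /= !eqxx.
Qed.

Lemma cintegral_sum (n : nat) (F : nat -> R -> R[i]) : (forall j, cinteg (F j)) ->
  cinteg (fun t => \sum_(j < n) F j t) /\
  cintegral D (fun t => \sum_(j < n) F j t) = \sum_(j < n) cintegral D (F j).
Proof.
move=> hF; elim: n => [|n [IH1 IH2]].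
  have -> : (fun t => \sum_(j < 0) F j t) = (fun t => 0 * F 0%N t).
    by apply/funext => t; rewrite big_ord0 mul0r.
  by split; [exact: cintegZ|rewrite cintegral_scale// mul0r big_ord0].
have -> : (fun t => \sum_(j < n.+1) F j t) = (fun t => \sum_(j < n) F j t + F n t).
  by apply/funext => t; rewrite big_ord_recr.
by split; [exact: cintegD|rewrite cintegral_add// IH2 big_ord_recr].
Qed.

(** The factor 2 is the price of bounding the real and imaginary integrals separately. *)
Lemma normc_cintegral_le f (g : R -> R) : cinteg f -> integ g ->
  (forall t, D t -> normc (f t) <= g t) ->
  normc (cintegral D f) <= 2 * \int[mu]_(t in D) g t.
Proof.
move=> [f1 f2] ig fg; rewrite (le_trans (normc_leReIm _))//=.
have -> : 2 * \int[mu]_(t in D) g t = \int[mu]_(t in D) g t + \int[mu]_(t in D) g t by ring.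
rewrite lerD// (le_trans (le_normr_Rintegral _ _))//; apply: le_Rintegral => //.
- exact: integ_norm.
- by move=> t Dt; rewrite (le_trans (normc_Re _)) ?fg.
- exact: integ_norm.
- by move=> t Dt; rewrite (le_trans (normc_Im _)) ?fg.
Qed.

Lemma cexp_osc (z : R[i]) (t : R) : cexp ('i%C * z * t%:C)
  = osc (complex.Re z) (complex.Im z) 0 t +i* osc (complex.Re z) (complex.Im z) (- (pi / 2)) t.
Proof.
rewrite /cexp /osc addr0 cosBpihalf; case: z => x y /=.
have -> : (0 * x - 1 * y) * t - (0 * y + 1 * x) * 0 = - (y * t) by ring.
have -> : (0 * x - 1 * y) * 0 + (0 * y + 1 * x) * t = x * t by ring.
by apply/eqP; rewrite eq_complex /= !mul0r subr0 addr0 !eqxx.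
Qed.

Lemma cinteg_cexp (z : R[i]) k : cinteg k -> cinteg (fun t => cexp ('i%C * z * t%:C) * k t).
Proof.
move=> [k1 k2]; split.
- by under eq_fun do rewrite cexp_osc ReM; apply: integB; exact: integ_osc.
- by under eq_fun do rewrite cexp_osc ImM; apply: integD; exact: integ_osc.
Qed.

Lemma fourier_decay k : cinteg k -> forall e : R, 0 < e ->
  exists B : R, forall z, B <= normc z ->
    normc (cintegral D (fun t => cexp ('i%C * z * t%:C) * k t)) <= e * weight z.
Proof.
(* Real and imaginary parts of both factors give four real integrals, each allotted a quarter of
   [e]. *)
move=> [k1 k2] e e0; have e4 : 0 < e / 4 by lra.
have [B1 B10 H1] := riemann_lebesgue k1 e4.
have [B2 B20 H2] := riemann_lebesgue k2 e4.
exists (Num.max B1 B2) => z; rewrite ge_max => /andP[z1 z2].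
rewrite -(ler_pXn2r (_ : 0 < 2)%N) ?nnegrE ?normc_ge0 ?(ltW B10)// sqr_normcE in z1.
rewrite -(ler_pXn2r (_ : 0 < 2)%N) ?nnegrE ?normc_ge0 ?(ltW B20)// sqr_normcE in z2.
rewrite (le_trans (normc_leReIm _))//=.
under eq_Rintegral do rewrite cexp_osc ReM.
under [X in _ + `|X|]eq_Rintegral do rewrite cexp_osc ImM.
rewrite RintegralB ?RintegralD//; [|exact: integ_osc..] => /=.
have -> : weight z = osc_bound (complex.Im z) by [].
have h1 := H1 _ _ 0 z1; have h2 := H1 _ _ (- (pi / 2)) z1.
have h3 := H2 _ _ 0 z2; have h4 := H2 _ _ (- (pi / 2)) z2.
rewrite (le_trans (lerD (ler_normB _ _) (ler_normD _ _)))//.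
have -> : e * osc_bound (complex.Im z) = (e / 4 * osc_bound (complex.Im z) + e / 4 * osc_bound (complex.Im z))
  + (e / 4 * osc_bound (complex.Im z) + e / 4 * osc_bound (complex.Im z)) by field.
by rewrite !lerD.
Qed.

Lemma cinteg_moment (j : nat) k : cinteg k -> cinteg (fun t => t%:C ^+ j * k t).
Proof.
have h (g : R -> R) : integ g -> integ (fun t => t ^+ j * g t).
  apply: (@integ_bounded_mul _ _ _ ((2 * pi) ^+ j)) => [|t].
    by apply: measurable_funTS; apply: continuous_measurable_fun; exact: exprn_continuous.
  rewrite /= in_itv /= => /andP[t0 t1].
  by rewrite normrX lerXn2r ?nnegrE ?mulr_ge0 ?pi_ge0// gtr0_norm// ltW.
move=> [k1 k2]; split.
- under eq_fun => t do rewrite -rmorphXn ReM /= mul0r subr0; exact: h.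
- under eq_fun => t do rewrite -rmorphXn ImM /= mul0r addr0; exact: h.
Qed.

(** A polynomial [T] close to the exponential on the disc of radius [2 pi r], which contains every
    [i z t], is integrated term by term against [k]; the result is a polynomial in [z] whose
    coefficients involve the moments of [k]. *)
Lemma entire_fourier k : cinteg k ->
  entire (fun z => cintegral D (fun t => cexp ('i%C * z * t%:C) * k t)).
Proof.
move=> ck r e e0; have [k1 k2] := ck.
pose g t := `|complex.Re (k t)| + `|complex.Im (k t)|.
have ig : integ g by apply: integD; exact: integ_norm.
(* The summand 1 keeps the denominator positive; the 2 in [2 * C] below absorbs the factor 2 of
   [normc_cintegral_le]. *)
pose C := 1 + \int[mu]_(t in D) g t.
have I0 : 0 <= \int[mu]_(t in D) g t by apply: Rintegral_ge0 => t _; exact: addr_ge0.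
have C0 : 0 < C by rewrite ltr_wpDr.
have [|T HT] := @entire_cexp R (r * (2 * pi)) (e / (2 * C)).
  by rewrite divr_gt0// mulr_gt0.
exists (\poly_(j < size T) (T`_j * 'i%C ^+ j * cintegral D (fun t => t%:C ^+ j * k t))).
move=> z zr.
have [cT ET] := @cintegral_sum (size T)
  (fun j t => (T`_j * 'i%C ^+ j * z ^+ j) * (t%:C ^+ j * k t))
  (fun j => cintegZ _ (cinteg_moment j ck)).
have TE t : \sum_(j < size T) (T`_j * 'i%C ^+ j * z ^+ j) * (t%:C ^+ j * k t)
    = T.['i%C * z * t%:C] * k t.
  rewrite horner_coef mulr_suml; apply: eq_bigr => j _.
  by rewrite !exprMn !mulrA.
have {}ET : cintegral D (fun t => T.['i%C * z * t%:C] * k t) =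
    (\poly_(j < size T) (T`_j * 'i%C ^+ j * cintegral D (fun t => t%:C ^+ j * k t))).[z].
  rewrite horner_poly -(funext TE) ET; apply: eq_bigr => j _.
  by rewrite cintegral_scale; [rewrite mulrAC|exact: cinteg_moment].
rewrite -ET; rewrite (funext TE) in cT.
have cN := cintegZ (-1) cT; have cE := cinteg_cexp z ck.
have -> : cintegral D (fun t => cexp ('i%C * z * t%:C) * k t) -
    cintegral D (fun t => T.['i%C * z * t%:C] * k t) =
    cintegral D (fun t => cexp ('i%C * z * t%:C) * k t + -1 * (T.['i%C * z * t%:C] * k t)).
  by rewrite cintegral_add// cintegral_scale// mulN1r.
apply: le_trans (_ : 2 * \int[mu]_(t in D) (e / (2 * C) * g t) <= _).
  apply: normc_cintegral_le; [exact: cintegD|exact: integZ|] => t Dt.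
  rewrite mulN1r -mulrBl normcM ler_pM ?normc_ge0 ?normc_leReIm//.
  apply: HT; move: Dt; rewrite /= in_itv /= => /andP[t0 t1].
  rewrite !normcM normc_i mul1r normc_real gtr0_norm//.
  by rewrite ler_pM ?normc_ge0 ?(ltW t0) ?(ltW t1).
have scal (I C' : R) : 0 < C' -> 2 * (e / (2 * C') * I) = e * (I / C').
  by move=> C'0; field; rewrite gt_eqF.
rewrite RintegralZl// scal//.
by rewrite ler_piMr ?(ltW e0)// ler_pdivrMr// mul1r /C lerDr.
Qed.

(** On a bounded interval L2 lies in L1, through [|k| <= 1 + |k| ^ 2]. *)
Lemma is_L2_cinteg k : is_L2 D k -> cinteg k.
Proof.
move=> [mr mi k2].
pose g t := normc (k t) ^+ 2.
have ig : integ g.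
  apply/integrableP; split.
    apply/measurable_EFinP.
    have -> : g = (fun t => complex.Re (k t) ^+ 2 + complex.Im (k t) ^+ 2).
      by apply/funext => t; exact: sqr_normcE.
    by apply: measurable_funD; exact: measurable_funX.
  under eq_integral do rewrite gee0_abs ?lee_fin ?exprn_ge0 ?normc_ge0//.
  exact: k2.
have i1 := integ_indic (@measurableT _ (measurableTypeR R)).
have ih := integD i1 ig.
have sqr_lb (a : R) : a <= 1 + a ^+ 2 by have := sqr_ge0 (a - 1); nra.
have key (h : R -> R) : measurable_fun D h -> (forall t, `|h t| <= normc (k t)) -> integ h.
  move=> mh hk; apply: (le_integrable mD _ _ ih).
    exact/measurable_EFinP.
  move=> t _ /=; rewrite indicT lee_fin (le_trans (hk t))// ger0_norm ?addr_ge0 ?exprn_ge0 ?normc_ge0//.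
by split; apply: key => // t; [exact: normc_Re|exact: normc_Im].
Qed.

End ComplexIntegral.

Theorem theorem3p13 (R : realType) (K : R -> R[i])
    (hK : is_L2 `]0, 2 * pi[ K) :
  exists (N : nat) (b0 : R), 0 < b0 /\
    forall (n : nat) (b : R), (N <= n)%N -> b0 <= b ->
      has_zeros (Phi K) (rectangle n b) (2 * n + 1)%N.
Proof.
have ck := cintegZ (- 'i%C) (is_L2_cinteg hK).
have hH := entire_fourier ck.
apply: has_zeros_perturbed_one_sub_cexp2pi.
  rewrite /Phi.
  apply: (entireD (fun z => 1 - cexp _) (fun z => - cintegral _ _)).
    exact: entire_one_sub_cexp2pi.
  under eq_fun do rewrite -mulN1r; exact: entireZ.
(* The difference from [1 - e^(2 pi i z)] is exactly minus the Fourier integral of [- i K]. *)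
move=> e e0; have [B HB] := fourier_decay ck e0; exists B => z /HB.
by rewrite /Phi addrAC subrr add0r normcN.
Qed.
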